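(* Let $(X,d)$ be a separable metric space and let $\mu$ be a Borel probability measure with full support on $X$. If $\dim_{\mathrm H}^d\mu<\infty$, then for every $p>0$ there is a metric $D$ on $X$, quasisymmetrically equivalent to $d$, such that $\dim_{\mathrm H}^D\mu\le p$. Consequently, $\dim_{\mathrm C}\mu=0$.
   Context: $\mu$ has full support if every nonempty open subset of $X$ has positive $\mu$-measure. For a metric $d$ on $X$, $\dim_{\mathrm H}^d E$ is the Hausdorff dimension of $E\subset X$ with respect to $d$, and $$\dim_{\mathrm H}^d\mu=\inf\{\dim_{\mathrm H}^dE:E\subset X\text{ Borel},\ \mu(X\setminus E)=0\}.$$ A homeomorphism $f:(X_1,d_1)\to(X_2,d_2)$ between metric spaces is quasisymmetric if there is a homeomorphism $\eta:[0,\infty)\to[0,\infty)$ with $$\frac{d_2(f(x),f(a))}{d_2(f(x),f(b))}\le\eta\!\left(\frac{d_1(x,a)}{d_1(x,b)}\right)$$ for all distinct $x,a,b\in X_1$. A metric $D$ on $X$ is quasisymmetrically equivalent to $d$ if the identity map $(X,d)\to(X,D)$ is a quasisymmetric homeomorphism. For a measure $\mu$ of full support, the conformal dimension is $\dim_{\mathrm C}\mu=\inf_f\dim_{\mathrm H}(f_\#\mu)$, where $f$ ranges over all quasisymmetric homeomorphisms from $(X,d)$ onto metric spaces $(Y,d_Y)$, $f_\#\mu(A)=\mu(f^{-1}(A))$ for Borel $A\subset Y$, and $$\dim_{\mathrm H}(f_\#\mu)=\inf\{\dim_{\mathrm H}^{d_Y}F:F\subset Y\text{ Borel},\ f_\#\mu(Y\setminus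 F)=0\},$$ with $\dim_{\mathrm H}^{d_Y}F$ the Hausdorff dimension of $F$ with respect to the target metric $d_Y$. *)

(* Defs.v *)
From HB Require Import structures.
From mathcomp Require Import all_boot all_order all_algebra.
From mathcomp Require Import all_classical all_reals all_analysis.
Set Implicit Arguments.
Unset Strict Implicit.
Unset Printing Implicit Defensive.
Import Order.TTheory GRing.Theory Num.Theory.
Import numFieldNormedType.Exports.
Local Open Scope classical_set_scope.
Local Open Scope ring_scope.

(* Measurable types are pointed in MathComp-Analysis, so a metric space that
   carries a measure is a pointed one. The base point plays no other role, and
   a space carrying a probability measure is nonempty anyway. *)
#[short(type="pmetricType")]
HB.structure Definition PointedMetric (K : numDomainType) :=
  { M of Pointed M & Metric K M }.

Section Topology.
Implicit Types X Y : topologicalType.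

Definition separable X := exists2 S : set X, countable S & dense S.

Definition borel X : set (set X) := <<s @open X >>.

Definition borelType (X : ptopologicalType) := g_sigma_algebraType (@open X).

Definition full_support (R : realType) X (mu : set X -> \bar R) :=
  forall U : set X, open U -> U !=set0 -> (0 < mu U)%E.

Definition homeomorphism X Y (f : X -> Y) :=
  continuous f /\
  exists g : Y -> X, [/\ continuous g, cancel f g & cancel g f].

Definition homeomorphism_on X Y (A : set X) (B : set Y) (f : X -> Y) :=
  [/\ set_fun A B f, {within A, continuous f} &
      exists g : Y -> X, [/\ set_fun B A g, {within B, continuous g},
        {in A, cancel f g} & {in B, cancel g f}]].

End Topology.
Arguments full_support {R} X mu.

Section Metrics.
Variable R : realType.

Record metric_on (T : Type) := MetricOn {
  metric_fun :> T -> T -> R ;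
  metric_funxx : forall x, metric_fun x x = 0 ;
  metric_fun_eq0 : forall x y, metric_fun x y = 0 -> x = y ;
  metric_funC : forall x y, metric_fun x y = metric_fun y x ;
  metric_fun_triangle : forall y x z,
    metric_fun x z <= metric_fun x y + metric_fun y z }.

(* The space (T, D): the carrier T with the metric D and its topology; any
   metric structure already present on T is forgotten. *)
Definition remetric (T : choiceType) (D : metric_on T) : Type := T.

HB.instance Definition _ (T : choiceType) (D : metric_on T) :=
  Choice.copy (remetric D) T.
HB.instance Definition _ (T : choiceType) (D : metric_on T) :=
  @isMetric.Build R (remetric D) (metric_fun D) (@metric_funxx T D)
    (@metric_fun_eq0 T D) (@metric_funC T D) (@metric_fun_triangle T D).

Definition quasisymmetric (X Y : metricType R) (f : X -> Y) :=
  homeomorphism f /\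
  exists2 eta : R -> R,
    @homeomorphism_on R R `[0, +oo[%classic `[0, +oo[%classic eta &
    forall x a b : X, x != a -> x != b -> a != b ->
      mdist (f x) (f a) / mdist (f x) (f b) <= eta (mdist x a / mdist x b).

Definition qs_equivalent (X : metricType R) (D : metric_on X) :=
  quasisymmetric (id : X -> remetric D).

End Metrics.

Section HausdorffDimension.
Context {R : realType} {X : metricType R}.
Implicit Types (A E : set X) (mu : set X -> \bar R).
Local Open Scope ereal_scope.

(* Adjoining 0 only matters for the empty set, whose diameter is 0. *)
Definition diam A : \bar R :=
  ereal_sup (0 |` [set (mdist p.1 p.2)%:E | p in A `*` A]).

(* (diam A)^s; the empty set contributes 0 for all s, while a nonempty set
   contributes 1 for s = 0, so that the 0-dimensional measure is counting. *)
Definition diam_pow (s : R) A : \bar R :=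
  if A == set0 then 0 else poweR (diam A) s.

Definition hausdorff_premeasure (s delta : R) E : \bar R :=
  ereal_inf [set \sum_(0 <= i <oo) diam_pow s (U i) | U in
    [set U : (set X)^nat | E `<=` \bigcup_i U i /\
                           forall i, diam (U i) <= delta%:E]].

Definition hausdorff_measure (s : R) E : \bar R :=
  ereal_sup [set hausdorff_premeasure s delta E |
    delta in [set delta : R | (0 < delta)%R]].

(* The infimum of the empty set is +oo. *)
Definition hausdorff_dim E : \bar R :=
  ereal_inf [set s%:E | s in
    [set s : R | (0 <= s)%R /\ hausdorff_measure s E = 0]].

Definition hausdorff_dim_measure mu : \bar R :=
  ereal_inf [set hausdorff_dim E | E in
    [set E : set X | borel E /\ mu (~` E) = 0]].

End HausdorffDimension.
Arguments hausdorff_dim_measure {R} X mu.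

(* The function B |-> mu (f @^-1` B) is [pushforward mu f]; it is unfolded
   because [pushforward] would require Y to be a pointed measurable type. *)
Definition conformal_dim (R : realType) (X : metricType R)
    (mu : set X -> \bar R) : \bar R :=
  ereal_inf [set r | exists (Y : metricType R) (f : X -> Y),
    quasisymmetric f /\
    r = hausdorff_dim_measure Y (fun B : set Y => mu (f @^-1` B))].
Arguments conformal_dim {R} X mu.

(* Main.v *)
Require Import Defs.
From mathcomp Require Import all_boot all_order all_algebra.
From mathcomp Require Import all_classical all_reals all_analysis.
From mathcomp Require Import measurable_realfun.
From mathcomp Require Import ring lra zify.
Set Implicit Arguments.
Unset Strict Implicit.
Unset Printing Implicit Defensive.
Import Order.TTheory GRing.Theory Num.Theory.
Import numFieldNormedType.Exports.
Local Open Scope classical_set_scope.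
Local Open Scope ring_scope.

(* For x in the metric space fix scales eps^k and, at every level j, a
   well-separated family Z_j of centres with radii t_j slightly below eps^j. Let
   rho_k(x) be the product over j < k of a factor that is tiny on the inner balls
   B(z, t_j / 2), equals 6 outside the balls B(z, t_j), and interpolates in
   between. The function d(x, y) rho_k(x), for eps^k comparable to d(x, y), is
   comparable to a metric D: the factor 6 compensates for collapsing the balls
   of one level, because a Lipschitz function can be made constant on B(z, t_j)
   at the cost of multiplying its Lipschitz constant by 6 on B(z, 2 t_j). Since
   the weights vary by at most powers in k, D is quasisymmetric to d.

   Finite dimension forces mu B(x, eps^k) >= eps^(k S) for infinitely many k at
   almost every x, hence mu is doubling at x at a positive proportion of the
   scales. At doubling points a bounded number of separated families is enough to
   cover, so choosing one of finitely many families per level by a derandomized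
   law of large numbers puts almost every x in inner balls of a positive
   proportion of the levels below infinitely many such k. If the factor on the
   inner balls is small enough, then B(x, eps^k) has D-diameter at most
   eps^(k B) with B p > S, while only eps^(-k S) such balls are needed, and the
   p-dimensional measure of a set of full measure vanishes. *)

(** * Power gauges *)

Section PowerGauge.
Variable R : realType.
Implicit Types (x s r C : R) (f g : R -> R) (l : nat).

Lemma continuous_max f g : continuous f -> continuous g ->
  continuous (fun x => Num.max (f x) (g x)).
Proof.
move=> fc gc x; under eq_fun do rewrite maxr_absE.
apply: cvgM; last exact: cvg_cst.
by apply: cvgD; [apply: cvgD|apply: cvg_norm; apply: cvgB];
  [exact: fc|exact: gc|exact: fc|exact: gc].
Qed.

Lemma continuous_min f g : continuous f -> continuous g ->
  continuous (fun x => Num.min (f x) (g x)).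
Proof.
move=> fc gc x; under eq_fun do rewrite minr_absE.
apply: cvgM; last exact: cvg_cst.
by apply: cvgB; [apply: cvgD|apply: cvg_norm; apply: cvgB];
  [exact: fc|exact: gc|exact: fc|exact: gc].
Qed.

Definition root2 l r : R := iter l Num.sqrt r.

Lemma root2_ge0 l r : 0 <= r -> 0 <= root2 l r.
Proof. by case: l => [//|l] _; exact: sqrtr_ge0. Qed.

Lemma root2K l r : 0 <= r -> root2 l r ^+ (2 ^ l) = r.
Proof.
elim: l r => [|l IH] r r0 /=; first by rewrite expn0 expr1.
by rewrite expnS exprM sqr_sqrtr ?root2_ge0// IH.
Qed.

Lemma exprK2 l r : 0 <= r -> root2 l (r ^+ (2 ^ l)) = r.
Proof.
move=> r0; elim: l => [|l IH]; first by rewrite expn0 expr1.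
by rewrite /root2 iterSr -/(root2 l _) expnS mulnC exprM sqrtr_sqr
  ger0_norm ?exprn_ge0.
Qed.

Lemma root2_continuous l : continuous (root2 l).
Proof.
elim: l => [|l IH] x; first exact: cvg_id.
apply: (@continuous_comp _ _ _ (root2 l) (@Num.sqrt R)); first exact: IH.
exact: sqrt_continuous.
Qed.

(** The exponent of the branch for large [r] is a power of two so that iterated square roots provide
    an explicit continuous inverse. *)
Definition gauge C l r := C * Num.max (Num.sqrt r) (r ^+ (2 ^ l)).

Definition gauge_inv C l s := Num.min ((s / C) ^+ 2) (root2 l (s / C)).

Lemma gauge_le1 C l r : 0 <= r <= 1 -> gauge C l r = C * Num.sqrt r.
Proof.
move=> /andP[r0 r1]; congr (_ * _); apply/max_idPl.
have s1 : Num.sqrt r <= 1 by rewrite -sqrtr1 ler_wsqrtr.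
have q : Num.sqrt r ^+ 2 = r by rewrite sqr_sqrtr.
apply: (@le_trans _ _ r); last by have := sqrtr_ge0 r; nra.
by rewrite -{2}(expr1 r) ler_wiXn2l// expn_gt0.
Qed.

Lemma gauge_ge1 C l r : 1 <= r -> gauge C l r = C * r ^+ (2 ^ l).
Proof.
move=> r1; congr (_ * _); apply/max_idPr.
have s1 : 1 <= Num.sqrt r by rewrite -sqrtr1 ler_wsqrtr.
have q : Num.sqrt r ^+ 2 = r by rewrite sqr_sqrtr//; lra.
apply: (@le_trans _ _ r); first by nra.
by rewrite -{1}(expr1 r) ler_weXn2l// expn_gt0.
Qed.

Lemma root2_le1 l r : 0 <= r <= 1 -> r <= root2 l r <= 1.
Proof.
move=> /andP[r0 r1]; elim: l => [|l /andP[h1 h2]]; first by rewrite lexx.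
have s0 := root2_ge0 l r0; have q : Num.sqrt (root2 l r) ^+ 2 = root2 l r.
  by rewrite sqr_sqrtr.
have := sqrtr_ge0 (root2 l r).
rewrite (_ : root2 l.+1 r = Num.sqrt (root2 l r))//.
by move=> ?; apply/andP; split; nra.
Qed.

Lemma root2_ge1 l r : 1 <= r -> 1 <= root2 l r <= r.
Proof.
move=> r1; elim: l => [|l /andP[h1 h2]]; first by rewrite lexx r1.
have s0 : 0 <= root2 l r by lra.
have q : Num.sqrt (root2 l r) ^+ 2 = root2 l r by rewrite sqr_sqrtr.
have := sqrtr_ge0 (root2 l r).
rewrite (_ : root2 l.+1 r = Num.sqrt (root2 l r))//.
by move=> ?; apply/andP; split; nra.
Qed.

Lemma gauge_inv_le1 C l s : 0 <= s / C <= 1 -> gauge_inv C l s = (s / C) ^+ 2.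
Proof.
move=> sC; apply/min_idPl; have /andP[h _] := root2_le1 l sC.
by apply: le_trans h; move/andP: sC => []; nra.
Qed.

Lemma gauge_inv_ge1 C l s : 1 <= s / C -> gauge_inv C l s = root2 l (s / C).
Proof.
move=> sC; apply/min_idPr; have /andP[_ h] := root2_ge1 l sC.
by apply: le_trans h _; nra.
Qed.

Lemma gauge_ge0 C l r : 0 < C -> 0 <= r -> 0 <= gauge C l r.
Proof.
by move=> C0 r0; rewrite /gauge mulr_ge0 ?(ltW C0)// le_max sqrtr_ge0.
Qed.

Lemma gauge_homeomorphism C l : 0 < C ->
  @homeomorphism_on R R `[0, +oo[%classic `[0, +oo[%classic (gauge C l).
Proof.
move=> C0; split.
- by move=> r /=; rewrite !in_itv/= !andbT => r0; exact: gauge_ge0.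
- apply: continuous_subspaceT => x; apply: cvgM; first exact: cvg_cst.
  by apply: continuous_max; [exact: sqrt_continuous|exact: exprn_continuous].
exists (gauge_inv C l); split.
- move=> s /=; rewrite !in_itv/= !andbT => s0.
  by rewrite le_min sqr_ge0/= root2_ge0// divr_ge0// ltW.
- apply: continuous_subspaceT => x.
  have dc : continuous (fun s => s / C).
    by move=> y; apply: cvgM; [exact: cvg_id|exact: cvg_cst].
  apply: continuous_min => y.
    apply: (@continuous_comp _ _ _ (fun s => s / C) (fun r => r ^+ 2)).
      exact: dc.
    exact: exprn_continuous.
  apply: (@continuous_comp _ _ _ (fun s => s / C) (root2 l)); first exact: dc.
  exact: root2_continuous.
- move=> r; rewrite inE/= in_itv/= andbT => r0.
  have Cu : C \is a GRing.unit by rewrite unitfE gt_eqF.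
  have [r1|/ltW r1] := leP r 1.
    rewrite gauge_le1 ?r0// gauge_inv_le1 mulrC mulKr ?sqr_sqrtr//.
    by rewrite sqrtr_ge0 -sqrtr1 ler_wsqrtr.
  rewrite gauge_ge1// gauge_inv_ge1 mulrC mulKr ?exprK2//.
  exact: exprn_ege1.
- move=> s; rewrite inE/= in_itv/= andbT => s0.
  have sC0 : 0 <= s / C by rewrite divr_ge0// ltW.
  have CK : C * (s / C) = s by rewrite mulrC divfK// gt_eqF.
  have [s1|/ltW s1] := leP (s / C) 1.
    rewrite gauge_inv_le1 ?sC0// gauge_le1 ?sqr_ge0 ?expr_le1//.
    by rewrite sqrtr_sqr ger0_norm.
  rewrite gauge_inv_ge1// gauge_ge1 ?root2K//.
  by have /andP[] := root2_ge1 l s1.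
Qed.

Lemma exprn_small (e r : R) : 0 <= e < 1 -> 0 < r -> exists n, e ^+ n < r.
Proof.
move=> /andP[e0 e1] r0.
have /cvgrPdist_lt/(_ _ r0)[N _ /(_ N (leqnn N))] :
    (GRing.exp e : R^nat) @ \oo --> (0 : R) by apply: cvg_expr; rewrite ger0_norm.
by rewrite sub0r normrN /= => h; exists N; exact: le_lt_trans (ler_norm _) h.
Qed.

End PowerGauge.

(** * Comparison of the weights at two levels *)

Section LevelRatio.
Variables (R : realType) (eps K : R) (N : nat) (r : nat -> R).
Hypothesis eps_gt0 : 0 < eps.
Hypothesis eps_le : 100 * eps <= 1.
Hypothesis K_ge0 : 0 <= K.
Hypothesis K_le : K <= eps^-1 ^+ N.
Hypothesis r_le : forall m i, r (m + i) <= 6 ^+ i * r m.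
Hypothesis r_ge : forall m i, r m <= K ^+ i * r (m + i).
Variables (p q : R) (n m : nat).
Hypothesis p_gt0 : 0 < p.
Hypothesis q_gt0 : 0 < q.
Hypothesis p_lo : eps ^+ n.+1 < p.
Hypothesis p_hi : (n == 0%N) || (p <= eps ^+ n).
Hypothesis q_lo : eps ^+ m.+1 < q.
Hypothesis q_hi : (m == 0%N) || (q <= eps ^+ m).

Let ie := eps^-1.
Let ie_gt0 : 0 < ie. Proof. by rewrite invr_gt0. Qed.
Let ie_ge1 : 1 <= ie. Proof. by rewrite invf_ge1//; have := eps_le; lra. Qed.

Let level_mono (a b : R) (i j : nat) : eps ^+ i.+1 < a ->
  (j == 0%N) || (b <= eps ^+ j) -> a <= b -> (j <= i)%N.
Proof.
move=> ai bj ab; rewrite leqNgt; apply/negP => ij.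
have j0 : (j == 0%N) = false by case: j {bj} ij.
move: bj; rewrite j0/= => bj; have : eps ^+ j <= eps ^+ i.+1.
  by rewrite ler_wiXn2l// ?(ltW eps_gt0)//; have := eps_le; lra.
by lra.
Qed.

(** With [n = m + i] the weight grows by at most [6 ^+ i], whereas [p / q <= eps ^+ (i - 1)] for
    [i > 0]. Since [36 * eps <= 1], half of the power of [p / q] absorbs this growth, up to a factor
    6. *)
Lemma level_ratio_small : p <= q ->
  exists2 c, 0 <= c & r n <= c * r m /\
    c * (p / q) <= 6 * Num.sqrt (p / q).
Proof.
move=> pq; have mn := level_mono p_lo q_hi pq.
pose i := (n - m)%N; have ni : n = (m + i)%N by rewrite subnKC.
exists (6 ^+ i); first exact: exprn_ge0.
split; first by rewrite ni; exact: r_le.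
have s0 : 0 < p / q by rewrite divr_gt0.
have s1 : p / q <= 1 by rewrite ler_pdivrMr// mul1r.
have ps : p = p / q * q by rewrite divfK// gt_eqF.
set s := p / q in s0 s1 ps *; clearbody s.
have qs := sqr_sqrtr (ltW s0); have qs0 := sqrtr_ge0 s.
suff h : 6 ^+ i * Num.sqrt s <= 6.
  rewrite -[in leLHS]qs expr2 mulrA; exact: ler_wpM2r.
rewrite -(@ler_pXn2r _ 2)// ?nnegrE ?mulr_ge0 ?exprn_ge0//.
rewrite exprMn qs -exprM mulnC exprM.
case Ei : i => [|j]; first by rewrite expr0 mul1r; nra.
have sj : s <= eps ^+ j.
  rewrite -(ler_pM2r q_gt0) -ps.
  have : p <= eps ^+ n by move: p_hi; rewrite ni Ei addnS.
  move=> /le_trans; apply; rewrite ni Ei (_ : (m + j.+1)%N = (j + m.+1)%N);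
    last by rewrite addnS -addSn addnC.
  have ej : 0 <= eps ^+ j by rewrite exprn_ge0// ltW.
  by rewrite exprD; apply: ler_wpM2l => //; exact: ltW.
rewrite exprS -mulrA ler_piMr ?exprn_ge0//.
apply: (@le_trans _ _ ((6 ^+ 2 * eps) ^+ j)).
  by rewrite [leRHS]exprMn; apply: ler_wpM2l => //; rewrite !exprn_ge0.
have e36 : 6 ^+ 2 * eps = 36 * eps :> R by rewrite -natrX.
have := eps_le; have := eps_gt0 => e0 e1.
by rewrite e36; apply: exprn_ile1; lra.
Qed.

(** The weight can drop by a factor [K] at each of the [i = m - n] levels, and
    [ie ^+ i <= ie * (p / q)]. As [K <= ie ^+ N], the total loss is bounded by a fixed power of the
    ratio. *)
Lemma level_ratio_large : q <= p ->
  exists2 c, 0 <= c & r n <= c * r m /\ c <= (ie * (p / q)) ^+ N.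
Proof.
move=> qp; have nm := level_mono q_lo p_hi qp.
pose i := (m - n)%N; have mi : m = (n + i)%N by rewrite subnKC.
exists (K ^+ i); first by rewrite exprn_ge0.
split; first by rewrite mi; exact: r_ge.
have s1 : 1 <= p / q by rewrite ler_pdivlMr// mul1r.
have ps : p = p / q * q by rewrite divfK// gt_eqF.
set s := p / q in s1 ps *; clearbody s.
have key : ie ^+ i <= ie * s.
  case Ei : i => [|j]; first by rewrite expr0 mulr_ege1.
  rewrite exprS ler_wpM2l ?(ltW ie_gt0)// -(ler_pM2r q_gt0) -ps.
  have qm : q <= eps ^+ m by move: q_hi; rewrite mi Ei addnS.
  apply: (@le_trans _ _ (ie ^+ j * eps ^+ m)).
    by rewrite ler_wpM2l ?exprn_ge0// ltW.
  rewrite mi Ei addnS -addSn exprD mulrCA -exprMn mulVf ?gt_eqF//.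
  by rewrite expr1n mulr1 ltW.
apply: (@le_trans _ _ ((ie ^+ i) ^+ N)).
  rewrite -exprM mulnC exprM lerXn2r// ?nnegrE ?exprn_ge0//; exact: ltW.
by rewrite lerXn2r// ?nnegrE ?exprn_ge0 ?mulr_ge0// ?(ltW ie_gt0)//; lra.
Qed.

(** The extra factor [ie] is there because [eps ^+ n] is comparable to the distance [p] only up to
    [ie]. For large ratios the exponent [N.+1] is rounded up to [2 ^ N.+1], the form of a gauge. *)
Lemma level_ratio : exists2 c, 0 <= c & r n <= c * r m /\
  c * (ie * (p / q)) <= gauge (6 * ie ^+ N.+1) N.+1 (p / q).
Proof.
have s0 : 0 < p / q by rewrite divr_gt0.
have ieN : 1 <= ie ^+ N by rewrite exprn_ege1.
have [pq|/ltW qp] := leP p q.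
  have [c c0 [rc cs]] := level_ratio_small pq; exists c => //; split => //.
  have s1 : p / q <= 1 by rewrite ler_pdivrMr// mul1r.
  rewrite gauge_le1 ?(ltW s0)// mulrCA exprS.
  have -> : 6 * (ie * ie ^+ N) * Num.sqrt (p / q) =
    ie * (ie ^+ N * (6 * Num.sqrt (p / q))) by ring.
  rewrite ler_wpM2l ?(ltW ie_gt0)//; apply: (le_trans cs).
  by rewrite ler_peMl// mulr_ge0// sqrtr_ge0.
have [c c0 [rc cs]] := level_ratio_large qp; exists c => //; split => //.
have s1 : 1 <= p / q by rewrite ler_pdivlMr// mul1r.
rewrite gauge_ge1//; apply: (@le_trans _ _ ((ie * (p / q)) ^+ N * (ie * (p / q)))).
  by rewrite ler_wpM2r// mulr_ge0// ltW.
rewrite -exprSr exprMn -mulrA.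
set s := p / q in s0 s1 *.
have sN : s ^+ N.+1 <= s ^+ (2 ^ N.+1) by rewrite ler_weXn2l// ltnW// ltn_expl.
have h0 : 0 <= ie ^+ N.+1 by rewrite exprn_ge0// ltW.
have := ler_wpM2l h0 sN.
have : 0 <= ie ^+ N.+1 * s ^+ (2 ^ N.+1).
  by rewrite mulr_ge0// exprn_ge0// ltW.
by move: (_ * _) (ie ^+ N.+1 * _) => a b; lra.
Qed.

End LevelRatio.

(* The library states these over a [realFieldType]; restating them over a
   [realType] makes [lra] see a single [mdist]. *)
Section MetricFacts.
Variables (R : realType) (X : metricType R).
Implicit Types x y z : X.

Lemma mdistC x y : mdist x y = mdist y x.
Proof. exact: metric_sym. Qed.

Lemma mdist_tri y x z : mdist x z <= mdist x y + mdist y z.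
Proof. exact: metric_triangle. Qed.

Lemma mdist0 x : mdist x x = 0.
Proof. exact: mdistxx. Qed.

Lemma mdist_nneg x y : 0 <= mdist x y.
Proof. exact: mdist_ge0. Qed.

End MetricFacts.

(** * Separated nets and doubling scales *)

Section MetricBalls.
Variables (R : realType) (X : metricType R).
Implicit Types (x y z : X) (G N : set X) (r e : R).

Lemma ballP x e y : ball x e y <-> mdist x y < e.
Proof. by rewrite ballEmdist. Qed.

Lemma mball_open x e : open (ball x e).
Proof.
rewrite openE => y /ballP xy; apply/nbhs_ballP; exists (e - mdist x y) => /=.
  by rewrite subr_gt0.
by move=> z /ballP yz; apply/ballP; have := mdist_tri y x z; lra.
Qed.

Definition separated_by e N :=
  forall x y, N x -> N y -> x != y -> e <= mdist x y.

Lemma maximal_separated e G : 0 < e -> exists N,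
  [/\ N `<=` G, separated_by e N &
      forall x, G x -> exists2 y, N y & mdist x y < e].
Proof.
move=> e0; have [|N [[NG Nsep] Nmax]] :=
    @Zorn_bigcup X [set N | N `<=` G /\ separated_by e N].
- move=> F FP Ftot; split=> [x [N FN Nx]|x y [N FN Nx] [M FM My] xy].
    by have [+ _] := FP _ FN; apply.
  have [NM|MN] := Ftot _ _ FN FM.
    by have [_] := FP _ FM; apply => //; exact: NM.
  by have [_] := FP _ FN; apply => //; exact: MN.
exists N; split => // x Gx; apply: contrapT => /forall2NP far.
have xfar y : N y -> e <= mdist x y.
  by move=> Ny; rewrite leNgt; apply/negP => xy; case: (far y) => // /(_ xy).
have Nx : ~ N x by move=> /xfar; rewrite mdist0 leNgt e0.
apply: (Nmax (x |` N)); last split.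
- split; first by move=> y Ny; right.
  by move=> sub; apply: Nx; apply: sub; left.
- by move=> y [->|/NG].
- move=> y z [->|Ny] [->|Nz]; rewrite ?eqxx//.
  + by move=> _; exact: xfar.
  + by move=> _; rewrite mdistC; exact: xfar.
  + exact: Nsep.
Qed.

Definition net e G : set X :=
  xget set0 [set N | [/\ N `<=` G, separated_by e N &
      forall x, G x -> exists2 y, N y & mdist x y < e]].

Lemma netP e G : 0 < e -> [/\ net e G `<=` G, separated_by e (net e G) &
  forall x, G x -> exists2 y, net e G y & mdist x y < e].
Proof.
move=> e0; rewrite /net; case: xgetP => [N _ //|noN].
by have [N NP] := maximal_separated G e0; case: (noN N).
Qed.

(* Peeling off the balls of radius [r / 2] around a maximal [5 r]-separated set
   again and again: a point that survives [c] rounds is within [5 r] of [c]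
   points that are mutually at distance at least [r / 2]. *)
Fixpoint residue r G c : set X :=
  if c is c'.+1 then
    residue r G c' `\` \bigcup_(z in net (5 * r) (residue r G c')) ball z (r / 2)
  else G.

Definition layer r G c : set X := net (5 * r) (residue r G c).

Lemma residue_sub r G c d : (c <= d)%N -> residue r G d `<=` residue r G c.
Proof.
move=> /subnKC <-; elim: (d - c)%N => [|i IH]; first by rewrite addn0.
by rewrite addnS => x [/IH].
Qed.

Lemma residue_crowd r G c x : 0 < r -> residue r G c x -> exists y : nat -> X,
  (forall i, (i < c)%N -> G (y i) /\ mdist x (y i) < 5 * r) /\
  (forall i j, (i < j < c)%N -> r / 2 <= mdist (y i) (y j)).
Proof.
move=> r0 xc; have r50 : 0 < 5 * r by lra.
have near i : (i < c)%N -> exists y, layer r G i y /\ mdist x y < 5 * r.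
  move=> ic; have [_ _ ] := netP (residue r G i) r50.
  by move=> /(_ x (residue_sub (ltnW ic) xc))[y Ny xy]; exists y.
have [y yP] : exists y : nat -> X,
    forall i, (i < c)%N -> layer r G i (y i) /\ mdist x (y i) < 5 * r.
  have /choice[y yP] : forall i, exists y,
      (i < c)%N -> layer r G i y /\ mdist x y < 5 * r.
    move=> i; have [/near[y yP]|] := boolP (i < c)%N; first by exists y.
    by move=> _; exists x.
  by exists y.
have ynet i : (i < c)%N -> residue r G i (y i).
  by move=> /yP[+ _]; have [+ _ _] := netP (residue r G i) r50; apply.
exists y; split=> [i ic|i j /andP[ij jc]].
  by have [_ ?] := yP _ ic; split => //; exact: residue_sub (leq0n i) _ (ynet _ ic).
have [yi _] := yP _ (ltn_trans ij jc).
(* As [i < j], the point [y j] survives round [i], which removes the ball of radius [r / 2] around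
   [y i]. *)
have [_ yj] := residue_sub ij (ynet _ jc).
rewrite leNgt; apply/negP => yij; apply: yj; exists (y i) => //.
exact/ballP.
Qed.

End MetricBalls.

(** * Packing of balls and covering of the doubling points *)

Section BorelProbability.
Variables (R : realType) (X : pmetricType R).
Variable mu : probability (borelType X) R.
Implicit Types (x y z : X) (A : set X) (r e : R).

Lemma open_borel A : open A -> @measurable _ (borelType X) A.
Proof. by move=> oA; exact: sub_sigma_algebra. Qed.

Lemma ball_borel x r : @measurable _ (borelType X) (ball x r).
Proof. by apply: open_borel; exact: mball_open. Qed.

Definition mass A : R := fine (mu A).

Lemma massE A : @measurable _ (borelType X) A -> mu A = (mass A)%:E.
Proof. by move=> mA; rewrite fineK// fin_num_measure. Qed.

Lemma mass_ge0 A : 0 <= mass A.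
Proof. by rewrite fine_ge0. Qed.

Lemma mass_le1 A : @measurable _ (borelType X) A -> mass A <= 1.
Proof. by move=> mA; rewrite -lee_fin -massE// probability_le1. Qed.

Lemma mass_le A A' : @measurable _ (borelType X) A ->
  @measurable _ (borelType X) A' -> A `<=` A' -> mass A <= mass A'.
Proof.
by move=> mA mA' AA'; rewrite -lee_fin -!massE// le_measure// inE.
Qed.

Lemma packing (y : nat -> X) n r A : @measurable _ (borelType X) A ->
    (forall i, (i < n)%N -> ball (y i) r `<=` A) ->
    (forall i j, (i < j < n)%N -> 2 * r <= mdist (y i) (y j)) ->
  \sum_(i < n) mass (ball (y i) r) <= mass A.
Proof.
move=> mA yA ysep; rewrite -lee_fin -massE// -sumEFin.
rewrite (eq_bigr (fun i : 'I_n => mu (ball (y i) r))); last first.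
  by move=> i _; rewrite -massE//; exact: ball_borel.
have mU : @measurable _ (borelType X) (\big[setU/set0]_(i < n) ball (y i) r).
  by apply: bigsetU_measurable => i _; exact: ball_borel.
rewrite -(@measure_semi_additive_ord_I _ _ _ mu (fun i => ball (y i) r))//;
  last 2 first.
- by move=> k _; exact: ball_borel.
- move=> i j /= iltn jltn [z [/ballP yiz /ballP yjz]].
  apply/eqP/negPn/negP; rewrite neq_ltn => /orP[ij|ji].
    have := ysep i j; rewrite ij jltn => /(_ isT).
    by have := mdist_tri z (y i) (y j); rewrite (mdistC z (y j)); lra.
  have := ysep j i; rewrite ji iltn => /(_ isT).
  by have := mdist_tri z (y j) (y i); rewrite (mdistC z (y i)); lra.
apply: le_measure; rewrite ?inE//.
by rewrite -(bigcup_mkord n (fun i => ball (y i) r)) => z [i /= /yA]; apply.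
Qed.

(** Balls of radius [r / 4] are disjoint around [r / 2]-separated points, and [11 * r] exceeds
    [5 * r + 21 / 4 * r], the radius at which such a point within [5 * r] of [x] sees the whole ball
    [A] in [layers_cover]. *)
Definition doubling_at (c r : R) x :=
  c * mass (ball x (11 * r)) <= mass (ball x (r / 4)).

(** A point missed by all layers survives [n] rounds, hence has [n] doubling points nearby whose
    balls of radius [r / 4] are disjoint and lie in the ball [A] around it. Each carries at least
    [c] times the mass of [A], which is positive by full support, and [n%:R * c > 1] gives a
    contradiction. *)
Lemma layers_cover (c r : R) n : full_support X mu -> 0 < r -> 0 <= c ->
    1 < n%:R * c ->
  forall x, doubling_at c r x -> exists i : 'I_n,
    exists2 z, layer r (doubling_at c r) i z & mdist z x < r / 2.
Proof.
move=> supp r0 c0 nc x Gx; apply: contrapT => /forallNP nox.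
have res i : (i <= n)%N -> residue r (doubling_at c r) i x.
  elim: i => [//|i IH] ilt; split; first exact: IH (ltnW ilt).
  move=> [z Nz /ballP zx]; apply: (nox (Ordinal ilt)); exists z => //.
have [y [yP ysep]] := residue_crowd r0 (res n (leqnn n)).
set A := ball x (21 / 4 * r).
have mA : 0 < mass A.
  rewrite -lte_fin -massE; last exact: ball_borel.
  apply: supp; first exact: mball_open.
  by exists x; apply/ballP; rewrite mdist0; lra.
have : \sum_(i < n) mass (ball (y i) (r / 4)) <= mass A.
  apply: packing; first exact: ball_borel.
    move=> i /yP[_ xy] z /ballP yz; apply/ballP.
    by have := mdist_tri (y i) x z; lra.
  by move=> i j /ysep; lra.
rewrite leNgt => /negP; apply.
apply: (@lt_le_trans _ _ (\sum_(i < n) c * mass A)).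
  rewrite sumr_const card_ord -mulr_natl mulrA.
  by rewrite -[ltLHS]mul1r ltr_pM2r.
apply: ler_sum => i _; have [Gy xy] := yP i (ltn_ord i).
apply: le_trans Gy; rewrite ler_wpM2l//; apply: mass_le; try exact: ball_borel.
move=> z /ballP xz; apply/ballP.
by have := mdist_tri x (y i) z; rewrite (mdistC (y i) x); lra.
Qed.

End BorelProbability.

(** * Lower density of measures of finite dimension *)

Section Diameter.
Variables (R : realType) (X : metricType R).
Implicit Types (U : set X) (x y : X) (s : R).

Lemma mdist_le_diam U x y : U x -> U y -> ((mdist x y)%:E <= diam U)%E.
Proof.
move=> Ux Uy; apply: ereal_sup_ubound; right.
by exists (x, y).
Qed.

Lemma diam_ge0 U : (0 <= diam U)%E.
Proof. by apply: ereal_sup_ubound; left. Qed.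

Lemma diam_pow_ge0 s U : (0 <= diam_pow s U)%E.
Proof. by rewrite /diam_pow; case: ifP => // _; exact: poweR_ge0. Qed.

Lemma diam_pow_fin s U x (r : R) : U x -> diam U = r%:E ->
  diam_pow s U = (r `^ s)%:E.
Proof.
move=> Ux Ur; rewrite /diam_pow Ur ifF//.
by apply/negP => /eqP U0; move: Ux; rewrite U0.
Qed.

End Diameter.

Section Density.
Variables (R : realType) (X : pmetricType R).
Variable mu : probability (borelType X) R.
Implicit Types (x y z : X) (A U : set X) (s e : R).

Lemma negligible_small A :
    (forall e, 0 < e -> exists B, [/\ @measurable _ (borelType X) B,
      A `<=` B & (mu B <= e%:E)%E]) ->
  mu.-negligible (A : set (borelType X)).
Proof.
move=> small.
have /choice[B BP] : forall n : nat, exists B,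
    [/\ @measurable _ (borelType X) B, A `<=` B & (mu B <= n.+1%:R^-1%:E)%E].
  by move=> n; apply: small; rewrite invr_gt0.
have mB : @measurable _ (borelType X) (\bigcap_n B n).
  by apply: bigcapT_measurable => n; have [] := BP n.
exists (\bigcap_n B n); split => //; last first.
  by move=> x Ax n _; have [_ + _] := BP n; apply.
rewrite (massE mu mB); congr EFin; apply/eqP; rewrite eq_le mass_ge0 andbT.
rewrite leNgt; apply/negP => /ltr_add_invr[n]; rewrite add0r ltNge => /negP.
apply; rewrite -lee_fin -massE//; have [mBn _] := BP n; apply: le_trans.
by apply: le_measure; rewrite ?inE// => x; apply.
Qed.

Lemma geometric_level e s : 0 < e < 1 -> 0 < s < 1 ->
  exists k, e ^+ k.+1 <= s < e ^+ k.
Proof.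
move=> /andP[e0 e1] /andP[s0 s1].
have exk : exists k, e ^+ k.+1 <= s.
  have [k ks] : exists k, e ^+ k < s by apply: exprn_small; rewrite // ltW.
  by exists k; rewrite (le_trans _ (ltW ks))// ler_wiXn2l// ltW.
exists (ex_minn exk); case: ex_minnP => k ks kmin; rewrite ks/=.
case: k ks kmin => [//|k] _ kmin; rewrite ltNge; apply/negP => /kmin.
by rewrite ltnn.
Qed.

Definition light (e : R) (S : nat) n : set X :=
  [set x | forall k, (n <= k)%N -> mass mu (ball x (e ^+ k)) < e ^+ (k * S)].

(** If [U] contains a light point [x], then [U] lies in a ball around [x] whose radius [e ^+ k] is
    comparable to the diameter of [U], and lightness at level [k] bounds its mass. The term [eta]
    pays for sets of diameter zero, for which no scale is comparable and [k] is taken large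
    instead. *)
Lemma light_piece (e s eta : R) (S n : nat) U : 0 < e < 1 -> 0 <= s <= S%:R ->
    (0 < S)%N -> (diam U <= (e ^+ n.+1)%:E)%E -> 0 < eta ->
  exists B, [/\ @measurable _ (borelType X) B, U `&` light e S n `<=` B &
    (mu B <= (e ^- S)%:E * diam_pow s U + eta%:E)%E].
Proof.
move=> e01 /andP[s0 sS] S0 dU eta0; have /andP[e0 e1] := e01.
have CP : (0 <= (e ^- S)%:E * diam_pow s U)%E.
  by rewrite mule_ge0 ?diam_pow_ge0// lee_fin invr_ge0 exprn_ge0// ltW.
have [[x [Ux lx]]|noU] := pselect (exists x, U x /\ light e S n x); last first.
  exists set0; split; first exact: measurable0.
    by move=> x [Ux lx]; apply: noU; exists x.
  by rewrite measure0 adde_ge0// lee_fin ltW.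
have dfin : diam U \is a fin_num.
  by rewrite ge0_fin_numE ?diam_ge0// (le_lt_trans dU)// ltry.
have Ur : diam U = (fine (diam U))%:E by rewrite fineK.
set r := fine (diam U) in Ur.
have r0 : 0 <= r by rewrite -lee_fin -Ur diam_ge0.
have rn : r <= e ^+ n.+1 by rewrite -lee_fin -Ur.
have Uball k : r < e ^+ k -> U `<=` ball x (e ^+ k).
  move=> rk y Uy; apply/ballP; apply: le_lt_trans rk.
  by rewrite -lee_fin -Ur; exact: mdist_le_diam.
suff [k [nk rk ek]] : exists k, [/\ (n <= k)%N, r < e ^+ k &
    e ^+ (k * S) <= e ^- S * r `^ s + eta].
  exists (ball x (e ^+ k)); split; first exact: ball_borel.
    by move=> y [Uy _]; exact: Uball Uy.
  rewrite massE; last exact: ball_borel.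
  rewrite (diam_pow_fin s Ux Ur) -EFinM -EFinD lee_fin.
  by rewrite (le_trans (ltW (lx k nk))).
have p0 : 0 <= r `^ s := powR_ge0 _ _.
have eS0 : 0 <= e ^- S by rewrite invr_ge0 exprn_ge0// ltW.
have [r00|rpos] := eqVneq r 0.
  have [k ke] : exists k, e ^+ k < eta by apply: exprn_small; rewrite // ltW.
  exists (maxn n k); rewrite leq_maxl r00 exprn_gt0//; split => //.
  apply: (@le_trans _ _ eta); last by rewrite lerDr mulr_ge0.
  apply: le_trans (ltW ke); rewrite ler_wiXn2l ?(ltW e0) ?(ltW e1)//.
  by rewrite (leq_trans (leq_maxr n k))// leq_pmulr.
have r1 : 0 < r < 1.
  by rewrite lt_neqAle eq_sym rpos r0/= (le_lt_trans rn)// exprn_ilt1// ltW.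
have [k /andP[kr rk]] := geometric_level e01 r1.
exists k; split => //.
  rewrite leqNgt; apply/negP => kn; have : e ^+ n <= e ^+ k.+1.
    by rewrite ler_wiXn2l ?(ltW e0) ?(ltW e1).
  have : e ^+ n.+1 < e ^+ n by rewrite exprS gtr_pMl ?exprn_gt0.
  by lra.
have powS : r `^ S%:R <= r `^ s.
  by apply: ger_powR => //; case/andP: r1 => -> /ltW ->.
rewrite powR_mulrn// in powS.
apply: (@le_trans _ _ (e ^- S * r `^ s)); last by rewrite lerDl ltW.
rewrite ler_pdivlMl ?exprn_gt0// -exprD.
apply: le_trans powS; rewrite -mulSn exprM lerXn2r// ?nnegrE ?exprn_ge0// ltW//.
Qed.

(** This is the mass distribution principle: the bound of [light_piece] is summed over a cover of
    small [s]-sum, with errors [eta / 2 ^ (i + 2)]. *)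
Lemma light_negligible (e s : R) (S n : nat) A : 0 < e < 1 -> 0 <= s <= S%:R ->
    (0 < S)%N -> hausdorff_measure s A = 0%E ->
  mu.-negligible (A `&` light e S n : set (borelType X)).
Proof.
move=> e01 sS S0 HA; have /andP[e0 e1] := e01.
apply: negligible_small => eta eta0.
pose C := e ^- S; have C0 : 0 < C by rewrite invr_gt0 exprn_gt0.
pose del := e ^+ n.+1; have del0 : 0 < del by rewrite exprn_gt0.
have pre : (hausdorff_premeasure s del A < (eta / (2 * C))%:E)%E.
  apply: (@le_lt_trans _ _ 0%E).
    by rewrite -HA; apply: ereal_sup_ubound; exists del.
  by rewrite lte_fin divr_gt0// mulr_gt0.
have [_ [U [AU dU] <-] sumU] := ereal_inf_lt pre.
have /choice[B BP] : forall i, exists B, [/\ @measurable _ (borelType X) B,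
    U i `&` light e S n `<=` B &
    (mu B <= C%:E * diam_pow s (U i) + (eta / 2 / (2 ^ i.+1)%:R)%:E)%E].
  move=> i; apply: light_piece => //.
  by rewrite !divr_gt0// ltr0n expn_gt0.
have mB i : @measurable _ (borelType X) (B i) by have [] := BP i.
have mUB : @measurable _ (borelType X) (\bigcup_i B i).
  exact: bigcup_measurable.
exists (\bigcup_i B i); split => //.
  move=> x [Ax lx]; have [i _ Ux] := AU x Ax; exists i => //.
  by have [_ + _] := BP i; apply.
apply: (@le_trans _ _ (\sum_(i <oo) mu (B i))%E).
  exact: measure_sigma_subadditive.
apply: (@le_trans _ _ (\sum_(i <oo) (C%:E * diam_pow s (U i) +
    (eta / 2 / (2 ^ i.+1)%:R)%:E))%E).
  by apply: lee_nneseries => // i _; have [] := BP i.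
have eta2 : 0 <= eta / 2 by rewrite divr_ge0// ltW.
apply: (le_trans (epsilon_trick _ _ eta2)).
  by move=> i; rewrite mule_ge0 ?diam_pow_ge0// lee_fin ltW.
rewrite nneseriesZl; last by move=> i _; exact: diam_pow_ge0.
have -> : eta%:E = ((eta / 2)%:E + (eta / 2)%:E)%E by rewrite -EFinD -splitr.
rewrite leeD2r// -(@lee_pdivlMl _ C)//; apply: (le_trans (ltW sumU)).
by rewrite -EFinM lee_fin invfM mulrA mulrC.
Qed.

(** The exponent [S] is an integer above some [s] for which a set of full measure is [s]-null. It
    does not depend on [e], so that [e] can be chosen later in terms of [S]. *)
Lemma heavy_ae : (hausdorff_dim_measure X mu < +oo)%E ->
  exists S : nat, (0 < S)%N /\ forall e, 0 < e < 1 ->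
    mu.-negligible ([set x | ~ forall n, exists2 k, (n <= k)%N &
      e ^+ (k * S) <= mass mu (ball x (e ^+ k))] : set (borelType X)).
Proof.
move=> /ereal_inf_lt[_ [E [bE E0] <-]] /ereal_inf_lt[_ [s [s0 Hs] <-]] _.
pose S := (Num.bound s).+1.
have sS : 0 <= s <= S%:R.
  rewrite s0/= (le_trans (ltW (archi_boundP s0)))//.
  by rewrite ler_nat /S.
exists S; split => // e e01.
apply: (@negligibleS _ _ _ mu ((~` E) `|` \bigcup_n (E `&` light e S n))).
  move=> x /existsNP[n nx]; have [Ex|] := pselect (E x); last by left.
  right; exists n => //; split => // k nk; rewrite ltNge; apply/negP => kx.
  by apply: nx; exists k.
apply: negligibleU.
  by exists (~` E); split => //; exact: (@measurableC _ (borelType X)).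
apply: negligible_bigcup => n.
exact: (@light_negligible e s S n E).
Qed.

End Density.

(** * Greedy selection *)

Lemma nneseries_geometric_le (R : realType) (f : nat -> \bar R) (c z : R) :
    0 <= c -> 0 < z < 1 -> (forall n, 0 <= f n)%E ->
    (forall n, f n <= (c * z ^+ n)%:E)%E ->
  (\sum_(n <oo) f n <= (c * (1 - z)^-1)%:E)%E.
Proof.
move=> c0 /andP[z0 z1] f0 fc; apply: lime_le.
  by apply: is_cvg_nneseries => n _ _; exact: f0.
apply: nearW => n; apply: (@le_trans _ _ (\sum_(0 <= i < n) (c * z ^+ i)%:E)%E).
  by apply: lee_sum => i _; exact: fc.
rewrite sumEFin lee_fin -[leLHS]/(series (geometric c z) n).
by apply: geometric_le_lim => //; rewrite gtr0_norm.
Qed.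

(* Choosing one of [Q.+1] sets at every step greedily, so that the integral of
   the potential [psi] does not increase, derandomizes the law of large numbers
   for independent uniform choices. *)
Section GreedySelection.
Context d (T : measurableType d) (R : realType) (P : probability T R).
Variables (Q : nat) (V : nat -> 'I_Q.+1 -> set T).
Hypothesis mV : forall j q, measurable (V j q).

Definition covered j : set T := \bigcup_q V j q.

Let a : R := (2 * Q.+1)%:R^-1.

(** At a covered point the average over a uniform [q] is at most [(1 + a) * (1 - a)], because at
    least one of the [Q.+1] sets halves the factor and [a] is half of [1 / Q.+1]. The gain [1 + a]
    rewards being covered, and the factor [1 / 2] penalizes a hit. *)
Definition factor j q (x : T) : R :=
  (1 + a * \1_(covered j) x) * (1 - 2^-1 * \1_(V j q) x).

Let a_gt0 : 0 < a. Proof. by rewrite invr_gt0 ltr0n. Qed.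

Let mcovered j : measurable (covered j).
Proof. exact: fin_bigcup_measurable. Qed.

Lemma factor_measurable j q : measurable_fun setT (factor j q).
Proof.
apply: measurable_funM.
  by apply: measurable_funD => //; apply: measurable_funM => //;
    exact: measurable_indic.
by apply: measurable_funB => //; apply: measurable_funM => //;
  exact: measurable_indic.
Qed.

Lemma factor_ge0 j q x : 0 <= factor j q x.
Proof.
rewrite mulr_ge0// /indic.
  by rewrite addr_ge0// mulr_ge0// ltW.
by case: (_ \in _); rewrite /=; lra.
Qed.

Lemma sum_factor_le j x : \sum_q factor j q x <= Q.+1%:R.
Proof.
rewrite -mulr_sumr sumrB sumr_const card_ord -mulr_sumr.
have [|] := boolP (x \in covered j); last first.
  move=> xC; rewrite {1}/indic (negbTE xC) mulr0 addr0 mul1r.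
  by rewrite lerBlDr lerDl mulr_ge0// sumr_ge0.
move=> xC; rewrite {1}/indic xC mulr1.
have [q _ Vq] : covered j x by apply/set_mem.
have s1 : 1 <= \sum_(i < Q.+1) (\1_(V j i) x : R).
  rewrite (bigD1 q)//= {1}/indic mem_set// lerDl sumr_ge0// => i _.
have aQ : a * Q.+1%:R = 2^-1.
  by rewrite /a natrM invfM -mulrA mulVf ?mulr1// pnatr_eq0.
by have := a_gt0; nra.
Qed.

(** By [sum_factor_le] the [Q.+1] integrals sum to at most [Q.+1] times the integral of [psi], so
    they cannot all exceed it. *)
Lemma greedy_choice j (psi : T -> R) : measurable_fun setT psi ->
    (forall x, 0 <= psi x) ->
  exists q, (\int[P]_x (psi x * factor j q x)%:E <= \int[P]_x (psi x)%:E)%E.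
Proof.
move=> mpsi psi0; pose I q := (\int[P]_x (psi x * factor j q x)%:E)%E.
pose J := (\int[P]_x (psi x)%:E)%E; rewrite -/J.
have I0 q : (0 <= I q)%E.
  by apply: integral_ge0 => x _; rewrite lee_fin mulr_ge0// factor_ge0.
have J0 : (0 <= J)%E by apply: integral_ge0 => x _; rewrite lee_fin.
have sumI : (\sum_q I q <= Q.+1%:R%:E * J)%E.
  rewrite /I -ge0_integral_sum//; last 2 first.
  - move=> q; apply/measurable_EFinP; apply: measurable_funM => //.
    exact: factor_measurable.
  - by move=> q x _; rewrite lee_fin mulr_ge0// factor_ge0.
  rewrite /J -ge0_integralZl_EFin//; last 2 first.
  - by move=> x _; rewrite lee_fin.
  - exact/measurable_EFinP.
  apply: ge0_le_integral => //.
  - move=> x _; rewrite sume_ge0// => q _.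
    by rewrite lee_fin mulr_ge0// factor_ge0.
  - apply: emeasurable_sum => q; apply/measurable_EFinP.
    by apply: measurable_funM => //; exact: factor_measurable.
  - by apply/measurable_EFinP; apply: measurable_funM.
  - move=> x _; rewrite sumEFin -EFinM lee_fin -mulr_sumr mulrC.
    by rewrite ler_wpM2r// sum_factor_le.
have [Joo|Joo] := eqVneq J +oo%E; first by exists ord0; rewrite Joo leey.
have Jfin : J \is a fin_num by rewrite ge0_fin_numE// ltey.
apply: contrapT => /forallNP noq.
have lt q : (J < I q)%E by rewrite ltNge; apply/negP/noq.
have : (\sum_(q < Q.+1) J < \sum_(q < Q.+1) I q)%E.
  by rewrite !big_ord_recl lte_leD// ?lee_sum// => [|q _];
    [rewrite sum_fin_num; apply/allP => z /mapP[? _ ->]|exact: ltW].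
rewrite ltNge; apply/negP; rewrite negbK; apply: le_trans sumI _.
by rewrite -(fineK Jfin) sumEFin -EFinM lee_fin sumr_const card_ord mulr_natl.
Qed.

Definition chosen (psi : T -> R) j : 'I_Q.+1 :=
  xget ord0 [set q | (\int[P]_x (psi x * factor j q x)%:E <=
                      \int[P]_x (psi x)%:E)%E].

Fixpoint psi k : T -> R :=
  if k is j.+1 then (fun x => psi j x * factor j (chosen (psi j) j) x)
  else cst 1.

Definition choice_seq j : 'I_Q.+1 := chosen (psi j) j.

Lemma psi_ge0 k x : 0 <= psi k x.
Proof.
by elim: k x => [|k IH] x /=; rewrite ?ler01// mulr_ge0// factor_ge0.
Qed.

Lemma psi_measurable k : measurable_fun setT (psi k).
Proof.
elim: k => [|k IH] /=; first exact: measurable_cst.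
by apply: measurable_funM => //; exact: factor_measurable.
Qed.

Lemma integral_psi_le1 k : (\int[P]_x (psi k x)%:E <= 1)%E.
Proof.
elim: k => [|k IH] /=.
  by rewrite integral_cst// mul1e probability_le1.
apply: le_trans IH; rewrite /chosen; case: xgetP => [q _ //|noq].
have [q qP] := greedy_choice k (@psi_measurable k) (psi_ge0 k).
by have := noq q.
Qed.

Definition hits k x : nat := (\sum_(j < k) (x \in V j (choice_seq j)))%N.
Definition covers k x : nat := (\sum_(j < k) (x \in covered j))%N.

Lemma psiE k x : psi k x = (1 + a) ^+ covers k x * 2^-1 ^+ hits k x.
Proof.
elim: k => [|k IH]; first by rewrite /covers /hits !big_ord0 mulr1.
rewrite /= IH /covers /hits !big_ord_recr/= !exprD.
rewrite /factor -/(choice_seq k) /indic.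
rewrite (_ : 1 + a * (x \in covered k)%:R = (1 + a) ^+ (x \in covered k)).
  rewrite (_ : 1 - _ = 2^-1 ^+ (x \in V k (choice_seq k))).
    by rewrite mulrACA.
  case: (x \in V _ _) => /=; rewrite ?mulr1 ?mulr0 ?subr0 ?expr0 ?expr1//.
  by rewrite [X in X - _](splitr 1) mul1r addrK.
by case: (x \in covered k) => /=; rewrite ?mulr1 ?mulr0 ?addr0 ?expr0 ?expr1.
Qed.

Lemma exprn_1D_ge (b : R) n : 0 <= b -> 1 + n%:R * b <= (1 + b) ^+ n.
Proof.
move=> b0; elim: n => [|n IH]; first by rewrite mul0r addr0.
rewrite exprS -natr1; have n0 : 0 <= n%:R :> R by [].
by have : 0 <= n%:R * b by [rewrite mulr_ge0]; nra.
Qed.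

Let b : R := expR (16 * Q.+1%:R)^-1.

(** Raise both sides to the power [n = 8 * Q.+1]. Then [b ^+ n] is the square root of e, hence at
    most 2, and Bernoulli's inequality gives [(1 + a) ^+ (2 * Q.+1) >= 2]. The right side is thus at
    least 2 to the power [4 * covers k x - n * hits k x], which is at least [k]. *)
Lemma psi_large k x : (k <= 2 * covers k x)%N ->
  (8 * Q.+1 * hits k x < k)%N -> b ^+ k <= psi k x.
Proof.
move=> kc hk; set n := (8 * Q.+1)%N.
have n0 : (0 < n)%N by [].
rewrite -(@ler_pXn2r _ n)// ?nnegrE ?psi_ge0 ?exprn_ge0 ?expR_ge0//.
apply: (@le_trans _ _ (2 ^+ k)).
  rewrite -exprM mulnC exprM lerXn2r// ?nnegrE ?exprn_ge0 ?expR_ge0//.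
  rewrite /b -expRM_natl (_ : n%:R * _ = 2^-1).
    have := expRxMexpNx_1 (2^-1 : R); have := expR_gt0 (2^-1 : R).
    have := expR_ge1Dx (- 2^-1 : R).
    set v := expR _; set u := expR _ => v2 u0 uv.
    have : 0 <= u * (v - (1 + - 2^-1)).
      by apply: mulr_ge0; [exact: ltW|rewrite subr_ge0].
    by rewrite mulrBr uv; lra.
  have q0 : Q.+1%:R != 0 :> R by rewrite pnatr_eq0.
  by rewrite /n natrM; move: (Q.+1%:R : R) q0 => y y0; field.
rewrite psiE exprMn -!exprM.
have two : 2 <= (1 + a) ^+ (2 * Q.+1).
  have := @exprn_1D_ge a (2 * Q.+1) (ltW a_gt0).
  by rewrite /a mulfV ?pnatr_eq0//; lra.
have -> : (covers k x * n = (2 * Q.+1) * (4 * covers k x))%N.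
  by rewrite /n; ring.
rewrite exprM.
apply: (@le_trans _ _ (2 ^+ (4 * covers k x) * 2^-1 ^+ (hits k x * n))).
  rewrite exprVn ler_pdivlMr ?exprn_gt0// -exprD ler_weXn2l ?ler1n//.
  by move: hk; rewrite -/n mulnC; lia.
rewrite ler_wpM2r ?exprn_ge0// lerXn2r// ?nnegrE ?exprn_ge0//.
by rewrite addr_ge0// ltW.
Qed.

(** Markov's inequality bounds the measure of the set where [psi k >= b ^+ k] by [b ^- k], and
    Borel-Cantelli excludes all but finitely many [k] almost everywhere. Too few hits would put the
    point in that set by [psi_large]. *)
Lemma greedy_selection : exists q : nat -> 'I_Q.+1, exists N : set T,
  [/\ measurable N, P N = 0%E & forall x, ~ N x -> exists k0, forall k,
    (k0 <= k)%N -> (k <= 2 * \sum_(j < k) (x \in covered j))%N ->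
    (k <= 8 * Q.+1 * \sum_(j < k) (x \in V j (q j)))%N].
Proof.
pose W k := [set x | b ^+ k <= psi k x].
have mW k : measurable (W k).
  rewrite -[W k]setTI; have := psi_measurable k.
  move=> /(_ measurableT `[b ^+ k, +oo[%classic (measurable_itv _)).
  by congr measurable; apply/seteqP; split => x [_ /=];
    rewrite in_itv/= andbT.
have b0 : 0 < b := expR_gt0 _.
have b1 : 1 < b by rewrite expR_gt1 invr_gt0.
have PW k : (P (W k) <= (1 * b^-1 ^+ k)%:E)%E.
  have le1 : ((b ^+ k)%:E * P (W k) <= 1)%E.
    apply: le_trans (integral_psi_le1 k); rewrite -integral_cst//.
    apply: (@le_trans _ _ (\int[P]_(x in W k) (psi k x)%:E)%E).
      apply: ge0_le_integral => //.
      + by move=> x _; rewrite lee_fin exprn_ge0// ltW.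
      + apply/measurable_EFinP; apply: measurable_funTS; exact: psi_measurable.
    apply: ge0_subset_integral => //.
      by apply/measurable_EFinP; exact: psi_measurable.
    by move=> x _; rewrite lee_fin psi_ge0.
  have bk : 0 < b ^+ k by rewrite exprn_gt0.
  rewrite mul1r exprVn -[leLHS]mul1e -(mulVf (lt0r_neq0 bk)) EFinM -muleA.
  rewrite -[leRHS]mule1; apply: lee_wpmul2l => //.
  by rewrite lee_fin invr_ge0 ltW.
exists choice_seq, (lim_sup_set W); split.
- apply: bigcapT_measurable => n; apply: bigcup_measurable => k _; exact: mW.
- apply: lim_sup_set_cvg0 => //.
  apply: le_lt_trans (@nneseries_geometric_le _ _ 1 b^-1 _ _ _ PW) _ => //.
  + by rewrite invr_gt0 b0/= invf_lt1.
  + by rewrite ltry.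
move=> x /existsNP[k0 xW]; exists k0 => k k0k kc; rewrite leqNgt.
apply/negP => hk; apply: xW => _; exists k => //=.
exact: psi_large.
Qed.

End GreedySelection.

(** * Dimension of limsup sets *)

(** Covers in the Hausdorff premeasure are single sequences, so a doubly indexed cover has to be
    enumerated. *)
Lemma nneseries_pair (R : realType) (v : nat -> nat -> \bar R) :
    (forall k i, 0 <= v k i)%E -> exists f : nat -> nat * nat,
  (forall p, exists m, f m = p) /\
  (\sum_(m <oo) v (f m).1 (f m).2 = \sum_(k <oo) \sum_(i <oo) v k i)%E.
Proof.
move=> v0; have /card_esym/ppcard_eqP[f] := card_nat2.
exists f; split.
  by move=> p; exists (f^-1%FUN p); rewrite invK ?inE.
rewrite nneseries_esumT; last by move=> m; exact: v0.
have fbij : set_bij [set: nat] [set: nat * nat] f by exact: bij.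
rewrite -(@reindex_esum R _ _ setT setT f (fun p => v p.1 p.2) fbij).
rewrite nneseries_esumT; last by move=> k; exact: nneseries_ge0.
rewrite (_ : [set: nat * nat] = [set: nat] `*`` (fun=> [set: nat])); last first.
  by apply/seteqP; split.
rewrite -esum_esum//; apply: eq_esum => k _.
by rewrite nneseries_esumT.
Qed.

(** For every [k0] the rows from [k0] on cover [E]. Their diameters are at most [c * z ^+ k0] and
    their [p]-sum is at most a geometric tail, so a large [k0] makes both as small as required. *)
Lemma hausdorff_limsup (R : realType) (Y : metricType R) (p c z : R)
    (E : set Y) (U : nat -> nat -> set Y) (n : nat -> nat) (d : nat -> R) :
    0 < p -> 0 < c -> 0 < z < 1 ->
    (forall k i, diam (U k i) <= (d k)%:E)%E ->
    (forall k, 0 <= d k <= c * z ^+ k) ->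
    (forall k, (n k)%:R * d k `^ p <= c * z ^+ k) ->
    (forall x k0, E x -> exists k i, [/\ (k0 <= k)%N, (i < n k)%N & U k i x]) ->
  hausdorff_measure p E = 0%E.
Proof.
move=> p0 c0 /andP[z0 z1] Ud dz nz EU.
have pre0 (s : R) (F : set Y) del : (0 <= hausdorff_premeasure s del F)%E.
  apply: le_ereal_inf_tmp => _ [V _ <-]; apply: nneseries_ge0 => k _ _.
  exact: diam_pow_ge0.
apply/eqP; rewrite eq_le; apply/andP; split; last first.
  apply: le_trans (ereal_sup_ubound _); first exact: (pre0 p E 1).
  by exists 1; rewrite /= ?ltr01.
apply: ge_ereal_sup => _ [del /= del0 <-]; apply/lee_addgt0Pr => e e0.
rewrite add0e.
pose C := c * (1 - z)^-1.
have C0 : 0 < C by rewrite divr_gt0// subr_gt0.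
have CE : c * (1 - z)^-1 = C by [].
clearbody C.
have [k0 k0e] : exists k0, z ^+ k0 < Num.min (del / c) (e / C).
  by apply: exprn_small; rewrite ?(ltW z0)// lt_min divr_gt0// divr_gt0.
move: k0e; rewrite lt_min !ltr_pdivlMr// => /andP[k0d k0e].
pose V k i := if (i < n (k0 + k))%N then U (k0 + k)%N i else set0.
have diam0 : diam (set0 : set Y) = 0%E.
  apply/eqP; rewrite eq_le diam_ge0 andbT; apply: ge_ereal_sup.
  by move=> _ [->//|[[? ?] [[]]]].
have diam_pow0 s : diam_pow s (set0 : set Y) = 0%E by rewrite /diam_pow eqxx.
have Vd k i : (diam (V k i) <= (d (k0 + k)%N)%:E)%E.
  rewrite /V; case: ifP => _; first exact: Ud.
  by rewrite diam0 lee_fin; have /andP[] := dz (k0 + k)%N.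
have Vp k i : (diam_pow p (V k i) <= (d (k0 + k)%N `^ p)%:E)%E.
  rewrite /diam_pow; case: ifP => _; first by rewrite lee_fin powR_ge0.
  have := Vd k i; have := diam_ge0 (V k i).
  case: (diam _) => [r| |]//; rewrite poweR_EFin !lee_fin => r0 rd.
  by apply: ge0_ler_powR; rewrite ?nnegrE ?(ltW p0)// (le_trans r0).
have rowV k : (\sum_(i <oo) diam_pow p (V k i) <= (c * z ^+ k0 * z ^+ k)%:E)%E.
  rewrite (nneseries_split 0 (n (k0 + k)%N)); last first.
    by move=> i _; exact: diam_pow_ge0.
  rewrite add0n [X in (_ + X)%E]eseries0 ?adde0; last first.
    by move=> i ni _; rewrite /V ltnNge ni/= diam_pow0.
  apply: (@le_trans _ _ (\sum_(0 <= i < n (k0 + k)%N) (d (k0 + k)%N `^ p)%:E)%E).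
    by apply: lee_sum => i _; exact: Vp.
  rewrite sumEFin lee_fin big_mkord sumr_const card_ord -mulr_natl.
  by rewrite -mulrA -exprD; exact: nz.
have [f [fsurj fsum]] := nneseries_pair (fun k i => diam_pow_ge0 p (V k i)).
apply: ge_ereal_inf; exists (\sum_(m <oo) diam_pow p (V (f m).1 (f m).2))%E.
  exists (fun m => V (f m).1 (f m).2) => //; split.
    move=> x Ex; have [k [i [kk ik Ux]]] := EU x k0 Ex.
    have [m fm] := fsurj ((k - k0)%N, i); exists m => //.
    by rewrite fm /V/= subnKC// ik.
  move=> m; apply: (le_trans (Vd _ _)); rewrite lee_fin.
  have /andP[_ h] := dz (k0 + (f m).1)%N; apply: (le_trans h).
  apply: (@le_trans _ _ (c * z ^+ k0)); last by rewrite mulrC ltW.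
  by rewrite ler_pM2l// ler_wiXn2l ?leq_addr ?(ltW z0) ?(ltW z1).
rewrite fsum.
apply: (le_trans (@nneseries_geometric_le _ _ (c * z ^+ k0) z _ _ _ rowV)).
- by rewrite mulr_ge0 ?exprn_ge0// ltW.
- by rewrite z0.
- by move=> k; apply: nneseries_ge0 => i _ _; exact: diam_pow_ge0.
rewrite lee_fin mulrAC CE mulrC; exact: ltW.
Qed.

(* Each block of [2 * M] levels without a good level among its first ones loses a
   factor [b ^+ (4 * S * M)], so more than half of the blocks being bad is
   incompatible with the lower bound on [mm]. *)
Lemma block_count (R : realType) (mm : nat -> R) (S M : nat)
    (good : nat -> bool) k (b : R) : 0 < b < 1 -> (0 < S)%N -> (0 < M)%N ->
    (forall i, 0 <= mm i) -> mm 0%N <= 1 -> (forall i, mm i.+1 <= mm i) ->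
    (forall j i, ~~ good j -> (i < M)%N ->
      mm (2 * M * j + i).+2 <= b ^+ (4 * S) * mm (2 * M * j + i).+1) ->
    b ^+ (2 * M * k * S) <= mm (2 * M * k)%N ->
  (k <= 2 * \sum_(j < k) good j)%N.
Proof.
move=> /andP[b0 b1] S0 M0 m0 m1 mS mgood mk.
have mono i j : (i <= j)%N -> mm j <= mm i.
  move=> /subnKC <-; elim: (j - i)%N => [|l IH]; first by rewrite addn0.
  by rewrite addnS (le_trans (mS _)).
have c0 l : 0 <= b ^+ l by rewrite exprn_ge0// ltW.
pose bad k := (\sum_(j < k) ~~ good j)%N.
have run j : ~~ good j -> forall i, (i <= M)%N ->
    mm (2 * M * j + i).+1 <= b ^+ (4 * S * i) * mm (2 * M * j)%N.
  move=> jbad; elim=> [|i IH] iM; first by rewrite muln0 addn0 mul1r.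
  rewrite addnS (le_trans (mgood _ _ jbad iM))// mulnS exprD -mulrA.
  by rewrite ler_wpM2l// IH// ltnW.
have decay l : mm (2 * M * l)%N <= b ^+ (4 * S * M * bad l).
  elim: l => [|l IH]; first by rewrite muln0 /bad big_ord0 muln0.
  have hl : (2 * M * l.+1 = 2 * M * l + 2 * M)%N by rewrite mulnS addnC.
  rewrite /bad big_ord_recr/= -/(bad l); have [gl|bl] := boolP (good l).
    by rewrite addn0 (le_trans _ IH)// mono// hl leq_addr.
  rewrite mulnDr muln1 addnC exprD.
  apply: (@le_trans _ _ (b ^+ (4 * S * M) * mm (2 * M * l)%N)); last first.
    by rewrite ler_wpM2l.
  apply: le_trans (run l bl M (leqnn M)); apply: mono; rewrite hl -addnS.
  by rewrite leq_add2l mul2n -addnn -{1}addn1 leq_add2l.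
have : (4 * S * M * bad k <= 2 * M * k * S)%N.
  rewrite -(ler_iXn2l b0 b1); exact: le_trans mk (decay k).
have -> : (2 * M * k * S = 2 * S * M * k)%N by ring.
have -> : (4 * S * M * bad k = 2 * S * M * (2 * bad k))%N by ring.
rewrite leq_pmul2l ?muln_gt0 ?S0// => bk.
have tot : (\sum_(j < k) good j + bad k = k)%N.
  rewrite /bad -big_split/= -[RHS]card_ord -sum1_card.
  by apply: eq_bigr => j _; case: (good j).
by move: tot bk; move: (\sum_(j < k) good j)%N (bad k) => g h; lia.
Qed.

(** * Lipschitz ramps around a set of centres *)

(** Take the supremum over the centres of truncated cones of slope [2 / t]; it inherits their
    Lipschitz constant. The value 0 is adjoined to cover the case of no centres. *)
Lemma ramp_exists (R : realType) (X : metricType R) (Z : set X) (t : R) :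
  0 < t -> exists u : X -> R, [/\ forall x, 0 <= u x <= 1,
    forall a b, `|u a - u b| <= 2 * mdist a b / t,
    forall a, u a != 0 -> exists2 z, Z z & mdist a z <= t &
    forall a z, Z z -> mdist z a < t / 2 -> u a = 1].
Proof.
move=> t0; pose r (a z : X) : R := Num.max 0 (Num.min 1 (2 - 2 * mdist a z / t)).
pose E a := [set v : R | v = 0 \/ exists2 z, Z z & v = r a z].
have r01 a z : 0 <= r a z <= 1.
  by rewrite /r le_max lexx/= ge_max ler01 ge_min lexx.
have Eub a : ubound (E a) 1.
  by move=> _ [->|[z _ ->]]; [exact: ler01|case/andP: (r01 a z)].
have Ebd a : has_ubound (E a) by exists 1.
have E0 a : E a !=set0 by exists 0; left.
have rlip a b z : r a z <= r b z + 2 * mdist a b / t.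
  have dab : 2 * mdist b z / t <= 2 * mdist a z / t + 2 * mdist a b / t.
    rewrite -mulrDl ler_pM2r ?invr_gt0// -mulrDr ler_pM2l//.
    by have := mdist_tri a b z; rewrite (mdistC b a); lra.
  have d0 : 0 <= 2 * mdist a b / t.
    by rewrite divr_ge0 ?(ltW t0)// mulr_ge0// mdist_nneg.
  rewrite /r; move: dab d0.
  move: (2 * mdist b z / t) (2 * mdist a z / t) (2 * mdist a b / t) => p q s.
  rewrite /Num.max /Num.min => h1 h2.
  by repeat case: ifPn; rewrite -?leNgt => *; lra.
have ulip a b : sup (E a) <= sup (E b) + 2 * mdist a b / t.
  have d0 : 0 <= 2 * mdist a b / t.
    by rewrite divr_ge0 ?(ltW t0)// mulr_ge0// mdist_nneg.
  apply: ge_sup => // _ [->|[z Zz ->]].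
    by rewrite addr_ge0//; apply: ub_le_sup => //; left.
  apply: (le_trans (rlip a b z)); rewrite lerD2r.
  by apply: ub_le_sup => //; right; exists z.
exists (fun a => sup (E a)); split.
- move=> a; apply/andP; split; last exact: ge_sup.
  by apply: ub_le_sup => //; left.
- move=> a b; have := ulip a b; have := ulip b a; rewrite (mdistC b a).
  by move=> h1 h2; rewrite ler_norml; apply/andP; split; lra.
- move=> a; apply: contraNP => /forall2NP noz; rewrite eq_le; apply/andP; split.
    apply: ge_sup => // _ [->//|[z Zz ->]]; rewrite /r ge_max lexx/=.
    rewrite ge_min; apply/orP; right; rewrite subr_le0 ler_pdivlMr//.
    by case: (noz z) => // /negP; rewrite -ltNge; lra.
  by apply: ub_le_sup => //; left.
- move=> a z Zz za; apply/eqP; rewrite eq_le; apply/andP; split.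
    exact: ge_sup.
  apply: ub_le_sup => //; right; exists z => //; rewrite /r mdistC.
  have z1 : 2 * mdist z a / t <= 1 by rewrite ler_pdivrMr//; lra.
  rewrite (_ : Num.min _ _ = 1); first exact/esym/max_idPr.
  by apply/min_idPl; lra.
Qed.

(** * The deformed metric *)

Section ConformalDeformation.
Variables (R : realType) (X : metricType R).
Variables (eps A : R) (t : nat -> R) (Z : nat -> set X) (u : nat -> X -> R).
Hypothesis eps_gt0 : 0 < eps.
Hypothesis eps_le : 100 * eps <= 1.
Hypothesis A_ge0 : 0 <= A.
Hypothesis t_le : forall j, 100 * t j <= eps ^+ j.
Hypothesis t_ge : forall j, eps ^+ j.+1 <= t j.
Hypothesis t_slow : forall j, 16 * A * eps ^+ j.+1 <= t j.
Hypothesis Z_sep :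
  forall j z z', Z j z -> Z j z' -> z != z' -> 5 * t j <= mdist z z'.
Hypothesis u_itv : forall j x, 0 <= u j x <= 1.
Hypothesis u_lip : forall j a b, `|u j a - u j b| <= 2 * mdist a b / t j.
Hypothesis u_supp :
  forall j a, u j a != 0 -> exists2 z, Z j z & mdist a z <= t j.

Implicit Types (x y z w a b : X) (F : X -> R) (m n k j : nat).

(** Level [j] contributes the factor [6 * expR (- (A * u j x))]. The exponential form turns the
    Lipschitz bounds on the [u j] into a bound on the ratio of the weights at two points. *)
Definition rho m x : R := 6 ^+ m * expR (- (A * \sum_(j < m) u j x)).

Let epsX_gt0 n : 0 < eps ^+ n. Proof. exact: exprn_gt0. Qed.

Let t_gt0 j : 0 < t j. Proof. exact: lt_le_trans (t_ge j). Qed.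

Lemma rho_gt0 m x : 0 < rho m x.
Proof. by rewrite mulr_gt0 ?expR_gt0// exprn_gt0. Qed.

Lemma rho0 x : rho 0 x = 1.
Proof. by rewrite /rho big_ord0 mulr0 oppr0 expR0 expr0 mulr1. Qed.

Lemma rhoS m x : rho m.+1 x = rho m x * (6 * expR (- (A * u m x))).
Proof.
by rewrite /rho big_ord_recr/= mulrDr opprD expRD exprSr; ring.
Qed.

Lemma rhoS_le m x : rho m.+1 x <= 6 * rho m x.
Proof.
rewrite rhoS mulrCA ler_wpM2l// ler_piMr// ?(ltW (rho_gt0 _ _))//.
by rewrite expR_le1 oppr_le0 mulr_ge0//; case/andP: (u_itv m x).
Qed.

Lemma rhoS_ge m x : rho m x <= expR A * rho m.+1 x.
Proof.
rewrite rhoS mulrCA ler_peMr// ?(ltW (rho_gt0 _ _))//.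
rewrite mulrCA -expRD; have /andP[? ?] := u_itv m x.
have : 0 <= A * (1 - u m x) by rewrite mulr_ge0// subr_ge0.
by have := expR_ge1Dx (A + - (A * u m x)); lra.
Qed.

Lemma rho_le m i x : rho (m + i) x <= 6 ^+ i * rho m x.
Proof.
elim: i => [|i IH]; first by rewrite addn0 mul1r.
by rewrite addnS (le_trans (rhoS_le _ _))// exprS -mulrA ler_wpM2l.
Qed.

Lemma rho_ge m i x : rho m x <= expR A ^+ i * rho (m + i) x.
Proof.
elim: i => [|i IH]; first by rewrite addn0 mul1r.
rewrite addnS (le_trans IH)// exprSr -mulrA ler_wpM2l// ?rhoS_ge//.

Qed.

Lemma rho_eps_le m i x :
  rho (m + i) x * eps ^+ (m + i) <= (6 * eps) ^+ i * (rho m x * eps ^+ m).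
Proof.
rewrite exprD exprMn [leRHS](_ : _ = 6 ^+ i * rho m x * (eps ^+ m * eps ^+ i)).
  by rewrite ler_wpM2r ?rho_le// mulr_ge0// exprn_ge0// ltW.
by ring.
Qed.

Lemma rho_eps_mono k n x : (n <= k)%N ->
  rho k x * eps ^+ k <= rho n x * eps ^+ n.
Proof.
move=> /subnKC <-; apply: (le_trans (rho_eps_le _ _ _)).
rewrite ler_piMl ?mulr_ge0 ?exprn_ge0 ?(ltW (rho_gt0 _ _)) ?(ltW eps_gt0)//.
by rewrite exprn_ile1//; have := eps_gt0; have := eps_le; lra.
Qed.

(* The series of slopes [A * 2 / t j] is dominated by a geometric one and its
   last term is small by [t_slow]. *)
Lemma harnack m a b : mdist a b <= 2 * eps ^+ m -> rho m a <= 2 * rho m b.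
Proof.
move=> dab.
have slope : 16 * A * eps ^+ m * \sum_(j < m) (t j)^-1 <= 2.
  elim: m {dab} => [|m IH]; first by rewrite big_ord0 mulr0.
  rewrite big_ord_recr/= mulrDr.
  have h : 16 * A * eps ^+ m.+1 * (t m)^-1 <= 1 by rewrite ler_pdivrMr ?mul1r.
  rewrite exprS (_ : 16 * A * (eps * eps ^+ m) * _ =
    eps * (16 * A * eps ^+ m * \sum_(i < m) (t i)^-1)); last by ring.
  rewrite -exprS.
  by have := eps_le; have := eps_gt0; nra.
have Adiff : A * (\sum_(j < m) u j b - \sum_(j < m) u j a) <= 1 / 2.
  rewrite -sumrB (@le_trans _ _ (A * (2 * mdist a b *
      \sum_(j < m) (t j)^-1)))//.
    rewrite ler_wpM2l// mulr_sumr ler_sum// => j _.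
    by rewrite (le_trans (ler_norm _))// distrC u_lip.
  have s0 : 0 <= \sum_(j < m) (t j)^-1.
    by rewrite sumr_ge0// => j _; rewrite invr_ge0 ltW.
  have : A * (2 * mdist a b * \sum_(j < m) (t j)^-1) <=
         A * (2 * (2 * eps ^+ m) * \sum_(j < m) (t j)^-1).
    by rewrite ler_wpM2l// ler_wpM2r// ler_wpM2l.
  by lra.
rewrite /rho mulrCA ler_wpM2l ?exprn_ge0// -[leLHS]mul1r.
have e2 : expR (1 / 2) <= 2 :> R.
  have : 1 / 2 <= expR (- (1 / 2)) :> R.
    by have := expR_ge1Dx (- (1 / 2) : R); lra.
  have := expRxMexpNx_1 (1 / 2 : R); have := expR_gt0 (1 / 2 : R).
  set p := expR _; set q := expR _; move=> *; nra.
have : expR (A * (\sum_(j < m) u j b - \sum_(j < m) u j a)) <= 2.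
  by apply: le_trans e2; rewrite ler_expR.
set sa := \sum_(j < m) u j a; set sb := \sum_(j < m) u j b => h.
rewrite mul1r (_ : - (A * sa) = A * (sb - sa) + - (A * sb)); last by ring.
by rewrite expRD ler_wpM2r// expR_ge0.
Qed.

(* The point itself when no centre of level [m] lies within [2 * t m]. *)
Definition near m w : X := xget w [set z | Z m z /\ mdist w z < 2 * t m].

Definition cutoff m z w : R := Num.min 1 (Num.max 0 (mdist w z / t m - 1)).

Definition flatten m F w : R :=
  F (near m w) + cutoff m (near m w) w * (F w - F (near m w)).

Definition lip_at m (L : R) F := forall a b, mdist a b <= eps ^+ m ->
  `|F a - F b| <= L * Num.max (rho m a) (rho m b) * mdist a b.

Lemma cutoff_itv m z w : 0 <= cutoff m z w <= 1.
Proof. by rewrite /cutoff le_min ler01 le_max lexx/= ge_min lexx. Qed.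

Lemma cutoff_lip m z a b :
  `|cutoff m z a - cutoff m z b| <= mdist a b / t m.
Proof.
have ab : mdist a z <= mdist a b + mdist b z := mdist_tri b a z.
have ba : mdist b z <= mdist a b + mdist a z.
  by rewrite (mdistC a b); exact: mdist_tri.
have dab : `|mdist a z / t m - mdist b z / t m| <= mdist a b / t m.
  rewrite -mulrBl normrM [X in _ * X <= _]gtr0_norm ?invr_gt0//.
  by rewrite ler_pM2r ?invr_gt0// ler_norml; apply/andP; split; lra.
apply: le_trans dab; rewrite /cutoff /Num.min /Num.max.
set p := _ / _; set q := _ / _.
repeat case: ifPn; rewrite -?leNgt ?subrr ?normr0//; intros;
  by rewrite ?normr_ge0// ler_norml; have := ler_norm (p - q);
    have := lerNnormlW (lexx `|p - q|); intros; apply/andP; split; lra.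
Qed.

Lemma near_eq m w z : Z m z -> mdist w z < 2 * t m -> near m w = z.
Proof.
move=> Zz wz; rewrite /near; case: xgetP => [y _ /= [Zy wy]|/(_ z)]; last first.
  by case.
apply/eqP/negPn/negP => yz; have := Z_sep Zy Zz yz.
have := mdist_tri w y z; rewrite (mdistC y w).
by have := t_gt0 m; lra.
Qed.

Lemma near_dist m w : mdist w (near m w) <= 2 * t m.
Proof.
rewrite /near; case: xgetP => [y _ /= [_ /ltW]//|_].
by rewrite mdist0 mulr_ge0// ltW.
Qed.

Lemma t2_le m : 2 * t m <= eps ^+ m.
Proof. by have := t_le m; have := t_gt0 m; lra. Qed.

Lemma rho_max_le m a b c : mdist c a <= 2 * eps ^+ m ->
  mdist c b <= 2 * eps ^+ m -> Num.max (rho m a) (rho m b) <= 2 * rho m c.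
Proof. by move=> ca cb; rewrite ge_max !harnack// mdistC. Qed.

Lemma flatten_diff m L F w : 0 <= L -> lip_at m L F ->
  `|flatten m F w - F w| <= 4 * L * rho m w * t m.
Proof.
move=> L0 FL; rewrite /flatten; set z := near m w.
have dwz : mdist w z <= 2 * t m := near_dist m w.
have dz : mdist w z <= eps ^+ m by rewrite (le_trans dwz)// t2_le.
have /andP[c0 c1] := cutoff_itv m z w.
rewrite (_ : _ - _ = - ((1 - cutoff m z w) * (F w - F z))); last by ring.
rewrite normrN normrM (ger0_norm (_ : 0 <= 1 - cutoff m z w)) ?subr_ge0//.
apply: (@le_trans _ _ `|F w - F z|).
  by rewrite ler_piMl// lerBlDr lerDl.
apply: (le_trans (FL _ _ dz)).
have : Num.max (rho m w) (rho m z) <= 2 * rho m w.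
  by apply: rho_max_le; rewrite ?mdist0; have := epsX_gt0 m; lra.
have M0 : 0 <= Num.max (rho m w) (rho m z) by rewrite le_max (ltW (rho_gt0 _ _)).
move=> Mle; rewrite (_ : 4 * L * rho m w * t m = L * (2 * rho m w) * (2 * t m)).
  by rewrite ler_pM// ?mulr_ge0 ?mdist_nneg// ler_wpM2l.
by ring.
Qed.

(** Between [2 * t m] and [3 * t m] from [z], separation leaves no other centre within [2 * t m] of
    [w]. There [near m w] is [w] itself, the cutoff at [z] is 1, and both sides are [F w]. *)
Lemma flattenE m F z w : Z m z -> mdist w z <= 3 * t m ->
  flatten m F w = F z + cutoff m z w * (F w - F z).
Proof.
move=> Zz wz; have [wz2|wz2] := ltP (mdist w z) (2 * t m).
  by rewrite /flatten (near_eq Zz wz2).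
have c1 : cutoff m z w = 1.
  rewrite /cutoff; apply/min_idPl; rewrite le_max; apply/orP; right.
  by rewrite lerBrDr ler_pdivlMr//; lra.
rewrite c1 mul1r addrC subrK /flatten /near.
case: xgetP => [y _ /= [Zy wy]|_]; last by rewrite subrr mulr0 addr0.
have [yz|yz] := eqVneq y z; first by move: wy; rewrite yz; lra.
have := Z_sep Zy Zz yz.
have := mdist_tri w y z; rewrite (mdistC y w).
by have := t_gt0 m; lra.
Qed.

Lemma u_eq0_near m z w : Z m z -> mdist w z <= 3 * t m -> t m < mdist w z ->
  u m w = 0.
Proof.
move=> Zz wz wz1; apply/eqP/negPn/negP => /u_supp[y Zy wy].
have [yz|yz] := eqVneq y z; first by move: wy; rewrite yz; lra.
have := Z_sep Zy Zz yz; have := mdist_tri w y z.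
by rewrite (mdistC y w); have := t_gt0 m; lra.
Qed.

Lemma rhoS_u0 m w : u m w = 0 -> rho m.+1 w = 6 * rho m w.
Proof. by move=> u0; rewrite rhoS u0 mulr0 oppr0 expR0 mulr1 mulrC. Qed.

(* Since [flatten m F] is constant on each [ball z (t m)], the Lipschitz
   constant only has to be controlled where [rho m.+1 = 6 * rho m]. *)
Lemma flatten_lip m L F : 0 <= L -> lip_at m L F -> lip_at m.+1 L (flatten m F).
Proof.
move=> L0 FL a b dab.
have dt : mdist a b <= t m := le_trans dab (t_ge m).
have dm : mdist a b <= eps ^+ m.
  by have := t_le m; have := t_gt0 m; lra.
have rmax0 p q : 0 <= Num.max (rho m p) (rho m q).
  by rewrite le_max (ltW (rho_gt0 _ _)).
have main c e z : Z m z -> mdist c z <= 3 * t m -> mdist e z <= mdist c z ->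
    mdist c e <= t m ->
    `|flatten m F c - flatten m F e| <= L * rho m.+1 c * mdist c e.
  move=> Zz cz ez ce; have ez3 := le_trans ez cz.
  rewrite !(flattenE F Zz)//.
  have [ct|ct] := leP (mdist c z) (t m).
    have c0 w : mdist w z <= mdist c z -> cutoff m z w = 0.
      move=> wz; rewrite /cutoff.
      have -> : Num.max 0 (mdist w z / t m - 1) = 0.
        by apply/max_idPl; rewrite lerBlDr ler_pdivrMr//; lra.
      by apply/min_idPr.
    rewrite !c0// !mul0r subrr normr0.
    by rewrite !mulr_ge0 ?mdist_nneg// ltW// rho_gt0.
  rewrite (rhoS_u0 (u_eq0_near Zz cz ct)).
  rewrite (_ : _ - _ = cutoff m z c * (F c - F e) +
     (cutoff m z c - cutoff m z e) * (F e - F z)); last by ring.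
  have dce : mdist c e <= eps ^+ m.
    by have := t_le m; have := t_gt0 m; lra.
  have tm := t_le m; have tm0 := t_gt0 m.
  have b1 : `|cutoff m z c * (F c - F e)| <= L * (2 * rho m c) * mdist c e.
    rewrite normrM (@le_trans _ _ `|F c - F e|)//.
      have /andP[? ?] := cutoff_itv m z c.
      by rewrite ler_piMl// ger0_norm.
    apply: (le_trans (FL _ _ dce)); rewrite ler_wpM2r ?mdist_nneg// ler_wpM2l//.
    by apply: rho_max_le; rewrite ?mdist0; lra.
  have b2 : `|(cutoff m z c - cutoff m z e) * (F e - F z)| <=
      (mdist c e / t m) * (L * (2 * rho m c) * (2 * t m)).
    have [ez2|ez2] := leP (mdist e z) (2 * t m); last first.
      have c1 w : 2 * t m < mdist w z -> cutoff m z w = 1.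
        move=> wz; rewrite /cutoff; apply/min_idPl.
        by rewrite le_max lerBrDr ler_pdivlMr//; apply/orP; right; lra.
      rewrite !c1//; last exact: lt_le_trans ez.
      by rewrite subrr mul0r normr0 !mulr_ge0 ?invr_ge0 ?mdist_nneg//; apply: ltW;
        rewrite ?rho_gt0.
    rewrite normrM ler_pM// ?cutoff_lip//.
    apply: (@le_trans _ _ (L * Num.max (rho m e) (rho m z) * mdist e z)).
      by apply: FL; lra.
    rewrite ler_pM ?mdist_nneg ?mulr_ge0// ler_wpM2l//.
    by apply: rho_max_le; lra.
  rewrite (le_trans (ler_normD _ _))//.
  have -> : L * (6 * rho m c) * mdist c e = L * (2 * rho m c) * mdist c e +
      mdist c e / t m * (L * (2 * rho m c) * (2 * t m)).
    by field; rewrite gt_eqF.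
  exact: lerD.
have [[z [Zz az]]|noz] :=
    pselect (exists z, Z m z /\ (mdist a z < 2 * t m \/ mdist b z < 2 * t m)).
  have abz := mdist_tri b a z; have baz := mdist_tri a b z.
  rewrite (mdistC b a) in baz.
  have az3 : mdist a z <= 3 * t m by case: az; lra.
  have bz3 : mdist b z <= 3 * t m by case: az; lra.
  have [ba|ab] := leP (mdist b z) (mdist a z).
    apply: (le_trans (main _ _ _ Zz az3 ba dt)).
    by rewrite ler_wpM2r ?mdist_nneg// ler_wpM2l// le_max lexx.
  rewrite distrC mdistC; rewrite mdistC in dt.
  apply: (le_trans (main _ _ _ Zz bz3 (ltW ab) dt)).
  by rewrite ler_wpM2r ?mdist_nneg// ler_wpM2l// le_max lexx orbT.
have nearid w : (forall z, ~ (Z m z /\ mdist w z < 2 * t m)) ->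
    flatten m F w = F w /\ rho m w <= rho m.+1 w.
  move=> now; split.
    rewrite /flatten /near; case: xgetP => [y _ /now//|_].
    by rewrite subrr mulr0 addr0.
  have u0 : u m w = 0.
    apply/eqP/negPn/negP => /u_supp[z Zz wz]; apply: (now z); split => //.
    by have := t_gt0 m; lra.
  by rewrite (rhoS_u0 u0); have := rho_gt0 m w; lra.
have [|-> ra] := nearid a; first by move=> z [Zz az]; apply: noz; exists z; auto.
have [|-> rb] := nearid b; first by move=> z [Zz az]; apply: noz; exists z; auto.
apply: (le_trans (FL _ _ dm)).
rewrite ler_wpM2r ?mdist_nneg// ler_wpM2l// ge_max !le_max ra rb/=.
by rewrite orbT.
Qed.

(* [G i - 2 * c i] increases and [G i + 2 * c i] decreases. *)
Lemma halving_limit (G c : nat -> R) :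
    (forall i, `|G i.+1 - G i| <= c i) -> (forall i, 2 * c i.+1 <= c i) ->
  exists l, (forall i, `|l - G i| <= 2 * c i) /\
    (forall M, (forall i, G i <= M) -> l <= M).
Proof.
move=> Gc cc; have c0 i : 0 <= c i := le_trans (normr_ge0 _) (Gc i).
have lo i j : (i <= j)%N -> G i - 2 * c i <= G j - 2 * c j.
  move=> /subnKC <-; elim: (j - i)%N => [|d IH]; first by rewrite addn0.
  rewrite addnS (le_trans IH)//; have := Gc (i + d)%N; have := cc (i + d)%N.
  by rewrite ler_norml => ? /andP[]; lra.
have up i j : (i <= j)%N -> G j + 2 * c j <= G i + 2 * c i.
  move=> /subnKC <-; elim: (j - i)%N => [|d IH]; first by rewrite addn0.
  rewrite addnS; apply: le_trans IH; have := Gc (i + d)%N; have := cc (i + d)%N.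
  by rewrite ler_norml => ? /andP[]; lra.
have lu i j : G i - 2 * c i <= G j + 2 * c j.
  have [ij|/ltnW ij] := leqP i j.
    by apply: (le_trans (lo _ _ ij)); have := c0 j; lra.
  by apply: le_trans (up _ _ ij); have := c0 i; lra.
pose E := [set G i - 2 * c i | i in setT].
have Eub : has_ubound E by exists (G 0%N + 2 * c 0%N) => _ [i _ <-].
have E0 : E !=set0 by exists (G 0%N - 2 * c 0%N); exists 0%N.
exists (sup E); split => [i|M GM].
  have l1 : G i - 2 * c i <= sup E by apply: ub_le_sup => //; exists i.
  have l2 : sup E <= G i + 2 * c i by apply: ge_sup => // _ [j _ <-].
  by rewrite ler_norml; apply/andP; split; lra.
by apply: ge_sup => // _ [j _ <-]; have := GM j; have := c0 j; lra.
Qed.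

(* Flattening [F] at all levels from [k] on turns a function that is Lipschitz
   for [rho k] at scale [eps ^+ k] into one that is admissible at all scales. *)
Fixpoint tower k F i : X -> R :=
  if i is i'.+1 then flatten (k + i') (tower k F i') else F.

Lemma tower_lip k F i : lip_at k 2 F -> lip_at (k + i) 2 (tower k F i).
Proof.
move=> FL; elim: i => [|i IH]; first by rewrite addn0.
by rewrite addnS; exact: flatten_lip.
Qed.

(* With [n = 0] allowed for all distances, this reads [|F a - F b| <= d(a, b)] at
   distances above 1, where the metric is not to be deformed. *)
Definition admissible F := forall n a b,
  (n == 0%N) || (mdist a b <= eps ^+ n) ->
  `|F a - F b| <= rho n a * Num.max (mdist a b) (eps ^+ n).

Lemma tower_limit k F : lip_at k 2 F ->
  exists H, (forall i w,
      100 * `|H w - tower k F i w| <= 16 * (rho (k + i) w * eps ^+ (k + i))) /\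
    (forall w M, (forall i, tower k F i w <= M) -> H w <= M).
Proof.
(* The bound [8 * rho * t] of [flatten_diff] with [L = 2] and [100 * t <= eps ^+ j] give the
   constant. These bounds at least halve from one level to the next because [12 * eps <= 1]. *)
move=> FL; pose c w i := 8 / 100 * (rho (k + i) w * eps ^+ (k + i)).
have lim w := @halving_limit (tower k F ^~ w) (c w).
have step w i : `|tower k F i.+1 w - tower k F i w| <= c w i.
  apply: (le_trans (flatten_diff w (ler0n _ 2) (@tower_lip _ _ i FL))).
  have := t_le (k + i); have := rho_gt0 (k + i) w; rewrite /c; nra.
have halve w i : 2 * c w i.+1 <= c w i.
  rewrite /c addnS exprS; have := rhoS_le (k + i) w.
  have := rho_gt0 (k + i) w; have := rho_gt0 (k + i).+1 w.
  have := epsX_gt0 (k + i); set r := rho (k + i) w; set r' := rho _.+1 w.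
  set e := eps ^+ _; move=> e0 r'0 r0 rr.
  have h : r' * e * (eps * 2) <= 6 * r * e * (eps * 2).
    by rewrite ler_wpM2r ?mulr_ge0 ?(ltW eps_gt0)// ler_wpM2r// ltW.
  have : 0 < r * e by rewrite mulr_gt0.
  by have := eps_le; have := eps_gt0; nra.
have [H HH] := choice (fun w => lim w (step w) (halve w)).
exists H; split => [i w|w M GM]; last by have [_ /(_ _ GM)] := HH w.
by have [/(_ i) + _] := HH w; rewrite /c; lra.
Qed.

(** At levels up to [k], [H] differs from [F] by a small multiple of the weight. At a level [n]
    beyond [k] it is compared with the stage [n - k] of the tower, which is Lipschitz for [rho n].
    Division by 6 absorbs the constants. *)
Lemma admissible_extension k F : lip_at k 2 F ->
    (forall n a b, (n <= k)%N -> (n == 0%N) || (mdist a b <= eps ^+ n) ->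
      `|F a - F b| <= 4 * (rho n a * Num.max (mdist a b) (eps ^+ n))) ->
  exists H, [/\ admissible (fun w => H w / 6),
    forall w, 100 * `|H w - F w| <= 16 * (rho k w * eps ^+ k) &
    forall w M, (forall i, tower k F i w <= M) -> H w <= M].
Proof.
move=> FL Fc; have [H [Hlim HM]] := tower_limit FL.
exists H; split => //; last first.
  by move=> w; have := Hlim 0%N w; rewrite addn0.
move=> n a b nab.
suff : `|H a - H b| <= 6 * (rho n a * Num.max (mdist a b) (eps ^+ n)).
  by rewrite -mulrBl normrM (gtr0_norm (_ : 0 < 6^-1))// ler_pdivrMr// mulrC.
have tri p q : `|H a - H b| <= `|p - q| + `|H a - p| + `|H b - q|.
  rewrite (_ : H a - H b = (p - q) + (H a - p) - (H b - q)); last by ring.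
  by rewrite (le_trans (ler_normB _ _))// lerD2r ler_normD.
have ra0 := rho_gt0 n a; have en := epsX_gt0 n.
have rem : rho n b * eps ^+ n <= 2 * (rho n a * Num.max (mdist a b) (eps ^+ n)).
  have [n0|n0 /=] := eqVneq n 0%N.
    rewrite n0 !rho0 !mul1r expr0.
    have M1 : 1 <= Num.max (mdist a b) 1 by rewrite le_max lexx orbT.
    by lra.
  apply: (@le_trans _ _ (2 * (rho n a * eps ^+ n))).
    rewrite mulrA ler_wpM2r ?(ltW en)// harnack// mdistC.
    by move: nab; rewrite (negbTE n0)/=; lra.
  by rewrite ler_wpM2l// ler_wpM2l ?(ltW ra0)// le_max lexx orbT.
have rema : rho n a * eps ^+ n <= rho n a * Num.max (mdist a b) (eps ^+ n).
  by rewrite ler_wpM2l ?(ltW ra0)// le_max lexx orbT.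
have re0 : 0 < rho n a * eps ^+ n by rewrite mulr_gt0.
have [nk|/ltnW kn] := leqP n k.
  have := tri (F a) (F b); have := Fc n a b nk nab.
  have := Hlim 0%N a; have := Hlim 0%N b; rewrite addn0/=.
  by have := rho_eps_mono a nk; have := rho_eps_mono b nk; lra.
have [n0|n0] := eqVneq n 0%N.
  have k0 : k = n by move: kn; rewrite n0 leqn0 => /eqP.
  have := tri (F a) (F b); have := Fc n a b _ nab.
  rewrite k0 leqnn => /(_ isT).
  by have := Hlim 0%N a; have := Hlim 0%N b; rewrite addn0/= k0; lra.
have dn : mdist a b <= eps ^+ n by move: nab; rewrite (negbTE n0).
have := tri (tower k F (n - k) a) (tower k F (n - k) b).
have := Hlim (n - k)%N a; have := Hlim (n - k)%N b; rewrite subnKC//.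
have := @tower_lip _ _ (n - k) FL a b; rewrite subnKC// => /(_ dn).
have : Num.max (rho n a) (rho n b) <= 2 * rho n a.
  by apply: rho_max_le; rewrite ?mdist0; lra.
have : 0 <= mdist a b := mdist_nneg a b.
have : 0 <= Num.max (rho n a) (rho n b) by rewrite le_max (ltW ra0).
move=> M0 d0 M1 h.
have : 2 * Num.max (rho n a) (rho n b) * mdist a b <= 2 * (2 * rho n a) * eps ^+ n.
  by apply: ler_pM => //; lra.
by lra.
Qed.

(** * Bump functions and separation of points *)

Definition bump k x (r : R) w : R := rho k x * Num.max 0 (r - mdist x w).

Lemma bump_lip1 k x r a b :
  `|bump k x r a - bump k x r b| <= rho k x * mdist a b.
Proof.
rewrite /bump -mulrBr normrM gtr0_norm ?rho_gt0// ler_wpM2l ?(ltW (rho_gt0 _ _))//.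
have := mdist_tri a x b; have := mdist_tri b x a; rewrite (mdistC b a) => h1 h2.
have d0 := mdist_nneg a b.
rewrite /Num.max; repeat case: ifPn; rewrite -?leNgt ?subrr ?normr0//; intros;
  by rewrite ler_norml; apply/andP; split; lra.
Qed.

Lemma bump_far k x r w : r <= mdist x w -> bump k x r w = 0.
Proof.
move=> rw; rewrite /bump (_ : Num.max _ _ = 0) ?mulr0//.
by apply/max_idPl; rewrite subr_le0.
Qed.

Lemma bump_bound k x r w : 0 <= r -> 0 <= bump k x r w <= rho k x * r.
Proof.
move=> r0; rewrite /bump mulr_ge0 ?(ltW (rho_gt0 _ _))// ?le_max ?lexx//=.
rewrite ler_wpM2l ?(ltW (rho_gt0 _ _))// ge_max r0/=.
by rewrite lerBlDr lerDl mdist_nneg.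
Qed.

Lemma bump_lip k x r : (k = 0%N) \/ (2 * r <= eps ^+ k) ->
  lip_at k 2 (bump k x r).
Proof.
move=> kr a b dab; have d0 := mdist_nneg a b.
have M0 : 0 <= Num.max (rho k a) (rho k b) by rewrite le_max (ltW (rho_gt0 _ _)).
have [ra|ar] := leP r (mdist x a); have [rb|br] := leP r (mdist x b).
- by rewrite !bump_far// subrr normr0 !mulr_ge0.
all: apply: (le_trans (bump_lip1 _ _ _ _ _)); rewrite ler_wpM2r//.
all: case: kr => [->|kr]; first by rewrite !rho0 maxxx; lra.
all: have e0 := epsX_gt0 k.
- apply: (@le_trans _ _ (2 * rho k b)); first by apply: harnack; lra.
  by rewrite ler_wpM2l// le_max lexx orbT.
- apply: (@le_trans _ _ (2 * rho k a)); first by apply: harnack; lra.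
  by rewrite ler_wpM2l// le_max lexx.
- apply: (@le_trans _ _ (2 * rho k a)); first by apply: harnack; lra.
  by rewrite ler_wpM2l// le_max lexx.
Qed.

Lemma epsX_mono n k : (n <= k)%N -> eps ^+ k <= eps ^+ n.
Proof.
by move=> nk; rewrite ler_wiXn2l// ?(ltW eps_gt0)//; have := eps_le; lra.
Qed.

(** For [k > 0] the oscillation of the bump is at most [rho n x * eps ^+ n]. If one of [a], [b] is
    within [r] of [x], then [rho n x] is comparable to [rho n a] by [harnack]; otherwise both values
    vanish. *)
Lemma bump_coarse k x r n a b : 0 <= r -> (k = 0%N) \/ (2 * r <= eps ^+ k) ->
    (n <= k)%N -> (n == 0%N) || (mdist a b <= eps ^+ n) ->
  `|bump k x r a - bump k x r b| <=
    4 * (rho n a * Num.max (mdist a b) (eps ^+ n)).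
Proof.
move=> r0 kr nk nab; have ra0 := rho_gt0 n a.
have en := epsX_gt0 n; have ek := epsX_gt0 k.
have M0 : 0 < Num.max (mdist a b) (eps ^+ n) by rewrite lt_max en orbT.
case: kr => [k0|kr].
  move: nk; rewrite k0 leqn0 => /eqP n0; rewrite n0 rho0 mul1r.
  apply: (le_trans (bump_lip1 _ _ _ _ _)); rewrite rho0 mul1r.
  apply: (@le_trans _ _ (Num.max (mdist a b) (eps ^+ 0))).
    by rewrite le_max lexx.
  by rewrite ler_peMl// ?ler1n//; rewrite -n0 ltW.
have Db : `|bump k x r a - bump k x r b| <= rho n x * eps ^+ n.
  have /andP[a1 a2] := bump_bound k x a r0.
  have /andP[b1 b2] := bump_bound k x b r0.
  have kx := rho_gt0 k x; have mono := rho_eps_mono x nk.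
  have : rho k x * r <= rho k x * eps ^+ k by rewrite ler_wpM2l ?(ltW kx)//; lra.
  by rewrite ler_norml => ?; apply/andP; split; lra.
have [[ra rb]|close] := pselect (r <= mdist x a /\ r <= mdist x b).
  by rewrite !bump_far// subrr normr0 !mulr_ge0 ?(ltW ra0) ?(ltW M0).
apply: (le_trans Db); apply: (@le_trans _ _ (2 * rho n a * eps ^+ n)); last first.
  have : rho n a * eps ^+ n <= rho n a * Num.max (mdist a b) (eps ^+ n).
    by rewrite ler_wpM2l ?(ltW ra0)// le_max lexx orbT.
  have re : 0 < rho n a * eps ^+ n by rewrite mulr_gt0.
  by lra.
rewrite ler_wpM2r ?(ltW en)//; have [n0|n0] := eqVneq n 0%N.
  by rewrite n0 !rho0; lra.
apply: harnack; have kn := epsX_mono nk.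
have dn : mdist a b <= eps ^+ n by move: nab; rewrite (negbTE n0).
have [ra|] := leP r (mdist x a); last by lra.
have [rb|] := leP r (mdist x b); first by exfalso; apply: close.
by have := mdist_tri b x a; rewrite (mdistC b a); lra.
Qed.

(** Flattening at level [k + i] enlarges the support by at most [2 * t (k + i)]. The enlargements
    form a small geometric sum, so the support never reaches distance [2 * r]. *)
Lemma tower_bump_supp k x r i w : eps ^+ k <= 2 * r ->
  2 * r - eps ^+ (k + i) / 4 <= mdist x w -> tower k (bump k x r) i w = 0.
Proof.
move=> kr; elim: i w => [|i IH] w /=.
  by rewrite addn0 => xw; apply: bump_far; have := epsX_gt0 k; lra.
rewrite addnS exprS => xw; set e := eps ^+ _ in xw.
have e0 : 0 < e := epsX_gt0 _; have ee : eps * e <= e / 100.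
  by have := eps_le; nra.
have far v : 2 * r - e / 4 <= mdist x v -> tower k (bump k x r) i v = 0.
  exact: IH.
have dn := near_dist (k + i) w; have := t_le (k + i); rewrite -/e => te.
have tri := mdist_tri (near (k + i) w) x w; rewrite (mdistC (near _ _) w) in tri.
have t0 := t_gt0 (k + i).
by rewrite /flatten (far w) ?(far (near _ _)) ?subrr ?mulr0 ?addr0//; lra.
Qed.

(** The tower over the bump vanishes at [y], so [H y <= 0], while the error at [x] still leaves
    [H x] at least half of [rho k x * r]. Together with the division by 6 this gives the factor
    12. *)
Lemma admissible_separates k x y r : eps ^+ k <= 2 * r -> 2 * r <= mdist x y ->
    (k = 0%N) \/ (2 * r <= eps ^+ k) ->
  exists2 F, admissible F & rho k x * r <= 12 * `|F x - F y|.
Proof.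
move=> kr rxy krr; have e0 := epsX_gt0 k; have r0 : 0 <= r by lra.
have [H [Ha Hx Hy]] := admissible_extension (bump_lip x krr)
  (fun n a b => @bump_coarse k x r n a b r0 krr).
exists (fun w => H w / 6) => //; rewrite -mulrBl normrM.
rewrite (gtr0_norm (_ : 0 < 6^-1))//.
have Hy0 : H y <= 0.
  by apply: Hy => i; rewrite tower_bump_supp//; have := epsX_gt0 (k + i); lra.
have := Hx x; rewrite {1}/bump mdist0 subr0 (_ : Num.max 0 r = r);
  last exact/max_idPr.
have rx := rho_gt0 k x; have rr0 : 0 <= rho k x * r by rewrite mulr_ge0// ltW.
have : rho k x * eps ^+ k <= rho k x * (2 * r).
  by rewrite ler_wpM2l// ltW.
have := ler_norm (H x - H y); have := lerNnormlW (lexx `|H x - rho k x * r|).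
by lra.
Qed.

(* As a supremum of pseudometrics this satisfies the triangle inequality and the
   upper bound for free; all the work goes into the lower bound. *)
Definition deformed_fun x y : R :=
  sup [set `|F x - F y| | F in admissible].

Lemma deformed_ub n x y : (n == 0%N) || (mdist x y <= eps ^+ n) ->
  ubound [set `|F x - F y| | F in admissible]
    (rho n x * Num.max (mdist x y) (eps ^+ n)).
Proof. by move=> nxy _ [F Fa <-]; exact: Fa. Qed.

Lemma deformed_set0 x y : [set `|F x - F y| | F in admissible] !=set0.
Proof.
exists 0; exists (fun=> 0); last by rewrite subrr normr0.
move=> n a b _; rewrite subrr normr0 mulr_ge0 ?(ltW (rho_gt0 _ _))//.
by rewrite le_max mdist_nneg.
Qed.

Lemma deformed_le n x y : (n == 0%N) || (mdist x y <= eps ^+ n) ->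
  deformed_fun x y <= rho n x * Num.max (mdist x y) (eps ^+ n).
Proof. by move=> nxy; apply: ge_sup (deformed_ub nxy); exact: deformed_set0. Qed.

Lemma deformed_ge F x y : admissible F -> `|F x - F y| <= deformed_fun x y.
Proof.
move=> Fa; apply: ub_le_sup; last by exists F.
by exists (rho 0 x * Num.max (mdist x y) (eps ^+ 0)); exact: deformed_ub.
Qed.

Lemma deformed_ge_rho k x y : eps ^+ k <= mdist x y ->
  rho k x * eps ^+ k <= 24 * deformed_fun x y.
Proof.
move=> kxy; have [|||F Fa] := @admissible_separates k x y (eps ^+ k / 2).
- by lra.
- by lra.
- by right; lra.
by have := deformed_ge x y Fa; lra.
Qed.

Lemma deformed_ge_mdist x y : 1 <= mdist x y ->
  mdist x y <= 24 * deformed_fun x y.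
Proof.
move=> xy; have [|||F Fa] := @admissible_separates 0 x y (mdist x y / 2).
- by rewrite expr0; lra.
- by lra.
- by left.
by have := deformed_ge x y Fa; rewrite rho0; lra.
Qed.

Lemma eps_level (r : R) : 0 < r ->
  exists n, eps ^+ n.+1 < r /\ ((n == 0%N) || (r <= eps ^+ n)).
Proof.
move=> r0; have e01 : 0 <= eps < 1.
  by rewrite (ltW eps_gt0)/=; have := eps_le; have := eps_gt0; lra.
have exn : exists n, eps ^+ n.+1 < r.
  have [n nr] := exprn_small e01 r0; exists n; apply: le_lt_trans nr.
  exact: epsX_mono.
exists (ex_minn exn); case: ex_minnP => n nr nmin; split => //.
case: n nr nmin => [//|n] nr nmin /=; rewrite leNgt; apply/negP => /nmin.
by rewrite ltnn.
Qed.

Lemma deformed_funxx x : deformed_fun x x = 0.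
Proof.
apply/eqP; rewrite eq_le; apply/andP; split.
  apply: ge_sup; first exact: deformed_set0.
  by move=> _ [F _ <-]; rewrite subrr normr0.
have [_ [F Fa _]] := deformed_set0 x x.
by rewrite -(normr0 R) -(subrr (F x)); exact: deformed_ge.
Qed.

Lemma deformed_fun_eq0 x y : deformed_fun x y = 0 -> x = y.
Proof.
move=> D0; apply/eqP/negPn/negP => xy.
have d0 : 0 < mdist x y by rewrite mdist_gt0.
have [n [nd _]] := eps_level d0; have := deformed_ge_rho (ltW nd).
rewrite D0 mulr0 leNgt mulr_gt0//; exact: rho_gt0.
Qed.

Lemma deformed_funC x y : deformed_fun x y = deformed_fun y x.
Proof.
congr sup; apply/seteqP; split=> _ [F Fa <-]; exists F => //; exact: distrC.
Qed.

Lemma deformed_fun_triangle y x z :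
  deformed_fun x z <= deformed_fun x y + deformed_fun y z.
Proof.
apply: ge_sup; first exact: deformed_set0.
move=> _ [F Fa <-]; rewrite (_ : F x - F z = (F x - F y) + (F y - F z)).
  by rewrite (le_trans (ler_normD _ _))// lerD// deformed_ge.
by ring.
Qed.

Definition deformed_metric : metric_on R X :=
  MetricOn deformed_funxx deformed_fun_eq0 deformed_funC deformed_fun_triangle.

(** * Quasisymmetry of the deformed metric *)

Lemma deformed_id_continuous : continuous (id : X -> remetric deformed_metric).
Proof.
move=> x; apply/cvg_ballP => e e0.
have [|n ne] := @exprn_small _ (6 * eps) e _ e0.
  by have := eps_le; have := eps_gt0; lra.
apply/nbhs_ballP; exists (eps ^+ n) => [|y]; first exact: epsX_gt0.
rewrite !ballEmdist/= => dxy.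
apply: le_lt_trans ne; apply: (@le_trans _ _ (rho n x * eps ^+ n)).
  have := @deformed_le n x y; rewrite (ltW dxy) orbT => /(_ isT).
  by rewrite (max_idPr (ltW dxy)).
by have := rho_eps_le 0 n x; rewrite !add0n rho0 expr0 !mulr1.
Qed.

Lemma deformed_id_continuousV :
  continuous (id : remetric deformed_metric -> X).
Proof.
move=> x; apply/(@cvg_ballP _ _ _ (nbhs (x : remetric deformed_metric))) => e e0.
have [|k ke] := @exprn_small _ eps e _ e0.
  by have := eps_le; have := eps_gt0; lra.
have rk := rho_gt0 k x; have ek := epsX_gt0 k.
apply/nbhs_ballP; exists (rho k x * eps ^+ k / 24) => [|y].
  by rewrite /= divr_gt0// mulr_gt0.
rewrite !ballEmdist/= => dxy; apply: le_lt_trans ke.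
rewrite leNgt; apply/negP => /ltW /deformed_ge_rho; move: dxy.
by rewrite -[mdist _ _]/(deformed_fun x y); lra.
Qed.

(** The lower bound is available at level [n.+1], and returning to level [n] costs [expR A / eps].
    Distances above 1 are covered by [deformed_ge_mdist]. *)
Lemma deformed_ge_level n x y :
  eps ^+ n.+1 < mdist x y -> (n == 0%N) || (mdist x y <= eps ^+ n) ->
  rho n x * Num.max (mdist x y) (eps ^+ n) <=
    24 * expR A / eps * deformed_fun x y.
Proof.
move=> lo hi.
have eA : 1 <= expR A by have := expR_ge1Dx A; have := A_ge0; lra.
have e1 : 1 <= eps^-1 by rewrite invf_ge1//; have := eps_le; lra.
have [d1|d1] := leP (mdist x y) (eps ^+ n).
  have h := deformed_ge_rho (ltW lo); have h2 := rhoS_ge n x.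
  rewrite exprS in h; have en := epsX_gt0 n.
  have : rho n x * eps ^+ n <= expR A * rho n.+1 x * eps ^+ n.
    by rewrite ler_wpM2r// ltW.
  move=> /le_trans; apply; rewrite -(ler_pM2r eps_gt0).
  rewrite (_ : 24 * expR A / eps * _ * eps = expR A * (24 * deformed_fun x y)).
    rewrite (_ : _ * eps = expR A * (rho n.+1 x * (eps * eps ^+ n))).
      by rewrite ler_wpM2l// expR_ge0.
    by ring.
  by field; rewrite gt_eqF.
have n0 : n = 0%N by move: hi; rewrite leNgt d1 orbF => /eqP.
move: d1; rewrite n0 rho0 mul1r expr0 => d1.
have D1 := deformed_ge_mdist (ltW d1); apply: (le_trans D1).
have D0 : 0 <= deformed_fun x y by lra.
rewrite ler_wpM2r// -mulrA ler_peMr//.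
by have := mulr_ege1 eA e1.
Qed.

(** The two-sided comparison of [deformed_fun x y] with [rho n x * Num.max (mdist x y) (eps ^+ n)]
    reduces the quotient to [level_ratio], with [K = expR A] and [N] such that
    [eps ^+ N < expR (- A)]. *)
Lemma deformed_quasisymmetric : qs_equivalent deformed_metric.
Proof.
split.
  split; first exact: deformed_id_continuous.
  by exists id; split => //; exact: deformed_id_continuousV.
have e01 : 0 <= eps < 1.
  by rewrite (ltW eps_gt0)/=; have := eps_le; have := eps_gt0; lra.
have [N NA] := exprn_small e01 (expR_gt0 (- A)).
pose Cl : R := 24 * expR A / eps.
have Cl0 : 0 < Cl by rewrite divr_gt0// mulr_gt0// expR_gt0.
pose ie := eps^-1; have ie0 : 0 < ie by rewrite invr_gt0.
have iee : eps * ie = 1 by rewrite divff// gt_eqF.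
have ie1 : 1 <= ie by rewrite invf_ge1//; have := eps_le; lra.
pose C := Cl * (6 * ie ^+ N.+1).
have C0 : 0 < C by rewrite mulr_gt0// mulr_gt0// exprn_gt0.
exists (gauge C N.+1); first exact: gauge_homeomorphism.
move=> x a b xa xb ab.
have da0 : 0 < mdist x a by rewrite mdist_gt0.
have db0 : 0 < mdist x b by rewrite mdist_gt0.
have [n [nlo nhi]] := eps_level da0; have [m [mlo mhi]] := eps_level db0.
have Db0 : 0 < deformed_fun x b.
  have := mulr_gt0 (rho_gt0 m.+1 x) (epsX_gt0 m.+1).
  by have := deformed_ge_rho (ltW mlo); lra.
rewrite -[X in X <= _]/(deformed_fun x a / deformed_fun x b).
rewrite ler_pdivrMr//.
have EA : expR A <= ie ^+ N.
  rewrite exprVn -[expR A]invrK -expRN lef_pV2 ?posrE ?expR_gt0 ?exprn_gt0//.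
  exact: ltW.
have [c c0 [rc cs]] := @level_ratio R eps (expR A) N (rho ^~ x)
  eps_gt0 eps_le (expR_ge0 A) EA (fun i j => rho_le i j x)
  (fun i j => rho_ge i j x) (mdist x a) (mdist x b) n m da0 db0 nlo nhi mlo mhi.
have das : mdist x a = mdist x a / mdist x b * mdist x b.
  by rewrite divfK// gt_eqF.
set s := mdist x a / mdist x b in cs das *.
have s0 : 0 < s by rewrite divr_gt0.
clearbody s.
have up : deformed_fun x a <= rho n x * (ie * (s * mdist x b)).
  apply: (le_trans (deformed_le nhi)).
  rewrite ler_wpM2l ?(ltW (rho_gt0 _ _))// -das ge_max; apply/andP; split.
    by rewrite ler_peMl// ltW.
  by rewrite -(ler_pM2l eps_gt0) mulrA iee mul1r -exprS; exact: ltW.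
have lo : rho m x * mdist x b <= Cl * deformed_fun x b.
  apply: le_trans (deformed_ge_level mlo mhi).
  by rewrite ler_wpM2l ?(ltW (rho_gt0 _ _))// le_max lexx.
apply: (le_trans up).
have cis0 : 0 <= c * (ie * s) by rewrite !mulr_ge0 ?(ltW s0) ?(ltW ie0).
apply: (@le_trans _ _ (c * (ie * s) * (rho m x * mdist x b))).
  have -> : c * (ie * s) * (rho m x * mdist x b) =
    c * rho m x * (ie * (s * mdist x b)) by ring.
  by rewrite ler_wpM2r// !mulr_ge0 ?(ltW s0) ?(ltW ie0) ?(ltW db0).
apply: (le_trans (ler_wpM2l cis0 lo)).
have -> : c * (ie * s) * (Cl * deformed_fun x b) =
    Cl * (c * (ie * s)) * deformed_fun x b by ring.
apply: ler_wpM2r; first exact: ltW.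
have -> : gauge C N.+1 s = Cl * gauge (6 * ie ^+ N.+1) N.+1 s.
  by rewrite /gauge mulrA.
by apply: ler_wpM2l cs; exact: ltW.
Qed.

Lemma deformation_exists : exists D : metric_on R X, qs_equivalent D /\
  forall n x y, (n == 0%N) || (mdist x y <= eps ^+ n) ->
    D x y <= rho n x * Num.max (mdist x y) (eps ^+ n).
Proof.
exists deformed_metric; split; first exact: deformed_quasisymmetric.
by move=> n x y nxy; exact: deformed_le.
Qed.

End ConformalDeformation.

(** * Choice of the nets and conclusion *)

(** Balls of radius [r] around [2 * r]-separated points of [G] are disjoint and have mass at least
    [w], so there are at most [1 / w] of them. A family of maximal size is a net. *)
Lemma finite_net (R : realType) (X : pmetricType R)
    (mu : probability (borelType X) R) (G : set X) (r w : R) :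
    0 < r -> 0 < w -> (forall x, G x -> w <= mass mu (ball x r)) ->
  exists n (y : nat -> X), [/\ n%:R * w <= 1, forall i, (i < n)%N -> G (y i) &
    forall x, G x -> exists2 i, (i < n)%N & mdist (y i) x < 2 * r].
Proof.
move=> r0 w0 Gw.
pose ok n (y : nat -> X) := (forall i, (i < n)%N -> G (y i)) /\
  (forall i j, (i < j < n)%N -> 2 * r <= mdist (y i) (y j)).
have bound n y : ok n y -> n%:R * w <= 1.
  move=> [yG ysep].
  have := @packing R X mu y n r setT measurableT (fun=> fun _ => @subsetT _ _) ysep.
  move=> h; apply: le_trans (mass_le1 mu (@measurableT _ (borelType X))).
  apply: le_trans h.
  rewrite mulr_natl -[n in leLHS]card_ord -sumr_const.
  by apply: ler_sum => i _; exact: Gw (yG i (ltn_ord i)).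
pose P n := `[< exists y, ok n y >].
have P0 : exists n, P n.
  exists 0%N; apply/asboolP; exists (fun=> point).
  by split=> [i|i j /andP[]].
have Pub n : P n -> (n <= Num.bound w^-1)%N.
  move=> /asboolP[y /bound nw]; rewrite -(ler_nat R).
  have wv0 : 0 <= w^-1 by rewrite invr_ge0 ltW.
  apply: le_trans (ltW (archi_boundP wv0)).
  by rewrite -[w^-1]mul1r ler_pdivlMr.
have [n /asboolP[y oky] nmax] := ex_maxnP P0 Pub; have [yG ysep] := oky.
exists n, y; split => //; first exact: bound oky.
move=> x Gx; apply: contrapT => /forall2NP far.
have xfar i : (i < n)%N -> 2 * r <= mdist (y i) x.
  by move=> ilt; rewrite leNgt; apply/negP; case: (far i) => // /(_ ilt).
suff /nmax : P n.+1 by rewrite ltnn.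
apply/asboolP; exists (fun i => if (i < n)%N then y i else x); split.
  by move=> i _; case: ifP => // /yG.
move=> i j /andP[ij jn]; rewrite ltnS in jn.
have ilt : (i < n)%N := leq_trans ij jn.
rewrite ilt; case: ifP => [jlt|_]; last exact: xfar.
by apply: ysep; rewrite ij jlt.
Qed.

Section Construction.
Variables (R : realType) (X : pmetricType R).
Variable mu : probability (borelType X) R.
Hypothesis supp : full_support X mu.
Implicit Types (x y z : X).

(** With [16 * r] and [r / 4] as consecutive powers of [b], the comparison of radii [11 * r] and
    [r / 4] in [doubling_at] follows from one step of the scale [b ^+ i]. *)
Let b : R := 64^-1.

Let b_itv : 0 < b < 1.
Proof. by rewrite invr_gt0 ltr0n/= invf_lt1// ltr1n. Qed.

Let b_gt0 : 0 < b. Proof. by case/andP: b_itv. Qed.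

Let b64 : 64 * b = 1. Proof. by rewrite divff// pnatr_eq0. Qed.

(* An index [q] below [M * P] encodes a scale [q %/ P] in the first half of the
   block and a layer [q %% P]; skipping the second half of each block keeps the
   weights of the previous levels almost constant at the scale of a block. *)
Lemma net_selection (S M P : nat) : (0 < S)%N -> (0 < M)%N -> (0 < P)%N ->
    1 < P%:R * b ^+ (4 * S) ->
  exists (t : nat -> R) (Z : nat -> set X),
  [/\ forall j, exists2 i, (i < M)%N & 16 * t j = b ^+ (2 * M * j + i).+1,
      forall j, separated_by (5 * t j) (Z j) &
      mu.-negligible ([set x | ~ exists k0, forall k, (k0 <= k)%N ->
        b ^+ (2 * M * k * S) <= mass mu (ball x (b ^+ (2 * M * k))) ->
        (k <= 8 * (M * P) * \sum_(j < k)
          (x \in \bigcup_(z in Z j) ball z (t j / 2)))%N] : set (borelType X))].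
Proof.
move=> S0 M0 P0 Pc; pose Q := (M * P).-1.
have QE : Q.+1 = (M * P)%N by rewrite prednK// muln_gt0 M0.
pose c := b ^+ (4 * S); pose tt j i := b ^+ (2 * M * j + i).+1 / 16.
have c0 : 0 <= c by rewrite exprn_ge0// ltW.
have tt0 j i : 0 < tt j i by rewrite divr_gt0// exprn_gt0.
pose ZZ j (q : 'I_Q.+1) :=
  layer (tt j (q %/ P)%N) (doubling_at mu c (tt j (q %/ P)%N)) (q %% P).
pose V j (q : 'I_Q.+1) : set (borelType X) :=
  \bigcup_(z in ZZ j q) ball z (tt j (q %/ P)%N / 2).
have mV j q : measurable (V j q).
  by apply: open_borel; apply: bigcup_open => z _; exact: mball_open.
have [q [N [mN N0 NP]]] := greedy_selection mu mV.
exists (fun j => tt j (q j %/ P)%N), (fun j => ZZ j (q j)); split.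
- move=> j; exists (q j %/ P)%N; last by rewrite mulrC divfK.
  by rewrite ltn_divLR// -QE.
- move=> j; rewrite /ZZ /layer.
  by have [] := netP (residue (tt j (q j %/ P)%N)
    (doubling_at mu c (tt j (q j %/ P)%N)) (q j %% P))
    (mulr_gt0 (ltr0n _ 5) (tt0 j (q j %/ P)%N)).
exists N; split => // x /= nox; apply: contrapT => /NP[k0 k0P]; apply: nox.
exists k0 => k /k0P hk heavy; rewrite -QE; apply: hk.
pose mm i := mass mu (ball x (b ^+ i)).
have ballS (e e' : R) : e <= e' ->
    mass mu (ball x e) <= mass mu (ball x e').
  move=> ee; apply: mass_le; try exact: ball_borel.
  by move=> y /ballP xy; apply/ballP; exact: lt_le_trans ee.
apply: (@block_count R mm S M (fun j => x \in covered V j) k b) => //.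
- by move=> i; exact: mass_ge0.
- by apply: mass_le1; exact: ball_borel.
- move=> i; apply: ballS; rewrite exprS ler_piMl ?exprn_ge0 ?(ltW b_gt0)//.
  by case/andP: b_itv => _ /ltW.
(* If the mass does not drop by [c] at this scale, then [x] is doubling there. Some layer [a]
   catches it, and the pair of scale [i] and layer [a] is the index [i * P + a]. *)
move=> j i xnot iM; rewrite leNgt; apply/negP => good.
move/negP: xnot; apply; apply/mem_set.
have dbl : doubling_at mu c (tt j i) x.
  rewrite /doubling_at.
  have -> : tt j i / 4 = b ^+ (2 * M * j + i).+2.
    rewrite /tt [in RHS]exprS mulrC -[LHS]mul1r -{1}b64 mulrA.
    by rewrite (_ : 64 * b * 4^-1 * _ = b * (b ^+ (2 * M * j + i).+1)) //; field.
  apply: le_trans (ltW good); rewrite ler_wpM2l// ballS//.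
  rewrite /tt mulrCA ler_piMr ?exprn_ge0 ?(ltW b_gt0)//.
  by rewrite ler_pdivrMr// mul1r ler_nat.
have [a [z Za zx]] := layers_cover supp (tt0 j i) c0 Pc dbl.
have iaQ : (i * P + a < Q.+1)%N.
  rewrite QE; apply: (@leq_trans (i.+1 * P)); last by rewrite leq_mul2r iM orbT.
  by rewrite mulSn addnC ltn_add2r.
have qE : ((i * P + a) %/ P = i)%N by rewrite divnMDl// divn_small// addn0.
have rE : ((i * P + a) %% P = a)%N by rewrite modnMDl modn_small.
exists (Ordinal iaQ) => //; exists z; first by rewrite /ZZ/= qE rE.
by rewrite /= qE; apply/ballP.
Qed.

(** The first factor is quadratic in [M] and [b ^+ M] decays exponentially. With [M = C] the first
    factor is exactly the cube of [C]. *)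
Lemma scale_exists (P B : nat) : (0 < P)%N -> (0 < B)%N ->
  exists2 M, (0 < M)%N &
    256 * (8 * (M * P) * (128 * (M * B)))%:R * b ^+ M <= 1.
Proof.
move=> P0 B0; pose C := (256 * (8 * P * (128 * B)))%N.
have C0 : (0 < C)%N by rewrite !muln_gt0 P0 B0.
exists C; first exact: C0.
rewrite exprVn ler_pdivrMr ?exprn_gt0// mul1r -natrM -natrX ler_nat.
have -> : (256 * (8 * (C * P) * (128 * (C * B))) = C * C * C)%N.
  by rewrite {3}/C; ring.
have lt2 n : (n <= 2 ^ n)%N by rewrite ltnW// ltn_expl.
apply: (@leq_trans (2 ^ C * 2 ^ C * 2 ^ C)); first by rewrite !leq_mul.
by rewrite -!expnMn leq_exp2r.
Qed.

Lemma borel_remetric (D : metric_on R X) (E : set X) :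
  qs_equivalent D -> borel E -> borel (E : set (remetric D)).
Proof.
move=> [[_ [g [gc idg gid]]] _]; apply: smallest_sub.
  exact: smallest_sigma_algebra.
move=> A oA; apply: sub_sigma_algebra.
have -> : (A : set (remetric D)) = g @^-1` A.
  by apply/seteqP; split => x /=; rewrite [g x]idg.
by move/continuousP : gc; apply.
Qed.

(** At least [k / Q] of the levels have [u j x = 1], so [A] times the sum is at least
    [64 * m * B * k], and [expR (- 64) <= b]. The growth [6 ^+ k] is absorbed by [eps ^+ k]. *)
Lemma rho_decay (A eps : R) (u : nat -> X -> R) (Zb : nat -> set X)
    (m B k Q : nat) x : 0 < eps -> 6 * eps <= 1 -> eps = b ^+ m ->
    (forall j, 0 <= u j x) -> (forall j, Zb j x -> u j x = 1) ->
    A = (Q * (64 * (m * B)))%:R ->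
    (k <= Q * \sum_(j < k) (x \in Zb j))%N ->
  rho A u k x * eps ^+ k <= eps ^+ (B * k).
Proof.
move=> e0 e6 eE u0 u1 AE hk.
have sumu : (\sum_(j < k) (x \in Zb j))%:R <= \sum_(j < k) u j x.
  rewrite natr_sum; apply: ler_sum => j _.
  by have [/set_mem/u1 ->|_] := boolP (x \in Zb j).
have Au : 64 * (m * B * k)%:R <= A * \sum_(j < k) u j x.
  apply: (@le_trans _ _ (A * (\sum_(j < k) (x \in Zb j))%:R)); last first.
    by rewrite ler_wpM2l// AE.
  rewrite AE -!natrM ler_nat mulnA (mulnC Q) -mulnA -!mulnA.
  by rewrite leq_mul2l/= !leq_mul2l hk !orbT.
rewrite /rho mulrAC -exprMn.
apply: (@le_trans _ _ (expR (- (A * \sum_(j < k) u j x)))).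
  by rewrite ler_piMl ?expR_ge0// exprn_ile1 ?mulr_ge0// ltW.
apply: (@le_trans _ _ (expR (- (64 * (m * B * k)%:R)))).
  by rewrite ler_expR lerN2.
have h64 : expR (- 64) <= b.
  rewrite expRN lef_pV2 ?posrE ?expR_gt0//.
  by apply: le_trans (expR_ge1Dx 64); rewrite lerDr.
rewrite -mulNr expRM_natr eE -exprM mulnA.
by rewrite lerXn2r// ?nnegrE ?expR_ge0// ltW.
Qed.

Lemma small_dimension_metric (p : R) : 0 < p ->
    (hausdorff_dim_measure X mu < +oo)%E ->
  exists2 D : metric_on R X, qs_equivalent D &
    (hausdorff_dim_measure (remetric D) mu <= p%:E)%E.
Proof.
move=> p0 hdim; have [S [S0 heavy]] := heavy_ae hdim.
(* The extra 1 in [S.+1] leaves a spare factor [eps ^+ k] that makes the series of [p]-th powers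
   converge. *)
have [B B0 Bp] : exists2 B, (0 < B)%N & S.+1%:R <= B%:R * p.
  exists (Num.bound (S.+1%:R / p)).+1 => //.
  have h : 0 <= S.+1%:R / p by rewrite divr_ge0// ltW.
  rewrite -ler_pdivrMr//; apply: (le_trans (ltW (archi_boundP h))).
  by rewrite ler_nat.
have [P P0 Pc] : exists2 P, (0 < P)%N & 1 < P%:R * b ^+ (4 * S).
  exists (64 ^ (4 * S)).+1 => //.
  by rewrite exprVn ltr_pdivlMr ?exprn_gt0// mul1r -natrX ltr_nat.
have [M M0 Mb] := scale_exists P0 B0.
(* This is the value required by [rho_decay] for [Q = 8 * (M * P)] and [m = 2 * M]. *)
pose A : R := (8 * (M * P) * (64 * (2 * M * B)))%:R.
have A0 : 0 <= A by [].
have {}Mb : 256 * A * b ^+ M <= 1.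
  rewrite /A (_ : 64 * (2 * M * B) = 128 * (M * B))%N//.
  by rewrite -!mulnA !mulnA.
have A1 : 1 <= A.
  by rewrite /A ler1n !muln_gt0 M0 P0 B0.
pose eps := b ^+ (2 * M).
have epsE j : eps ^+ j = b ^+ (2 * M * j) by rewrite exprM.
have e0 : 0 < eps by rewrite exprn_gt0.
have b0 := b_gt0; have b6 := b64.
have bM : b ^+ M <= b.
  by rewrite -{2}[b]expr1 ler_wiXn2l ?(ltW b0)//; lra.
have bMb : eps <= b * b.
  by rewrite /eps mulnC exprM expr2 ler_pM// exprn_ge0// ltW.
have e100 : 100 * eps <= 1 by nra.
have [t [Z [tE Zsep bad]]] := net_selection S0 M0 P0 Pc.
have t_lo j : b ^+ M * eps ^+ j <= 16 * t j.
  have [i iM ->] := tE j; rewrite epsE -exprD ler_wiXn2l ?(ltW b0)//; first by lra.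
  by rewrite -addnS addnC leq_add2r.
have t_hi j : 16 * t j <= b * eps ^+ j.
  have [i iM ->] := tE j; rewrite epsE -exprS ler_wiXn2l ?(ltW b0)//; first by lra.
  by rewrite ltnS leq_addr.
have ej0 j : 0 < eps ^+ j by rewrite exprn_gt0.
have bMpos : 0 < b ^+ M by rewrite exprn_gt0.
have epsS j : eps ^+ j.+1 = b ^+ M * (b ^+ M * eps ^+ j).
  by rewrite exprS /eps mulnC exprM expr2 mulrA.
have t0 j : 0 < t j.
  by have := t_lo j; have := mulr_gt0 bMpos (ej0 j); lra.
have t_le j : 100 * t j <= eps ^+ j.
  by have := t_hi j; have := ej0 j; nra.
have t_ge j : eps ^+ j.+1 <= t j.
  have h := mulr_gt0 bMpos (ej0 j); rewrite epsS.
  have := t_lo j; move: (t j) (b ^+ M * eps ^+ j) h => tj v v0 tv.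
  have : b ^+ M * v <= b * v by rewrite ler_wpM2r// ltW.
  by nra.
(* The selected scale lies in the first half of its block, so [eps ^+ j.+1] is smaller by a spare
   [b ^+ M], which absorbs [256 * A] by the choice of [M]. *)
have t_slow j : 16 * A * eps ^+ j.+1 <= t j.
  have h := mulr_gt0 bMpos (ej0 j); rewrite epsS.
  have := t_lo j; move: (b ^+ M * eps ^+ j) h => v v0 tv.
  have : 256 * A * b ^+ M * v <= 1 * v by rewrite ler_wpM2r// ltW.
  by lra.
have /choice[u uP] : forall j, exists u : X -> R, [/\ forall x, 0 <= u x <= 1,
    forall a b, `|u a - u b| <= 2 * mdist a b / t j,
    forall a, u a != 0 -> exists2 z, Z j z & mdist a z <= t j &
    forall a z, Z j z -> mdist z a < t j / 2 -> u a = 1].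
  by move=> j; exact: ramp_exists.
have u_itv j x : 0 <= u j x <= 1 by have [+ _ _ _] := uP j; apply.
have [D [qsD Dle]] := @deformation_exists R X eps A t Z u e0 e100 A0 t_le t_ge
  t_slow Zsep u_itv (fun j => let: And4 _ h _ _ := uP j in h)
  (fun j => let: And4 _ _ h _ := uP j in h).
exists D => //.
pose Zb j := \bigcup_(z in Z j) ball z (t j / 2).
pose G k := [set x | eps ^+ (k * S) <= mass mu (ball x (eps ^+ k)) /\
  (k <= 8 * (M * P) * \sum_(j < k) (x \in Zb j))%N].
have decay k x : G k x -> rho A u k x * eps ^+ k <= eps ^+ (B * k).
  move=> [_ hk]; apply: (@rho_decay A eps u Zb (2 * M) B k (8 * (M * P)) x) => //.
  - by lra.
  - by move=> j; case/andP: (u_itv j x).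
  - by move=> j [z Zz /ballP zx]; have [_ _ _] := uP j; apply; first exact: Zz.
(* Balls of radius [2 * eps ^+ k.+1] still have radius below [eps ^+ k], so the upper bound on [D]
   at level [k] applies to them. *)
have /choice[ny nyP] : forall k, exists ny : nat * (nat -> X),
    [/\ ny.1%:R * eps ^+ (k.+1 * S) <= 1,
      forall i, (i < ny.1)%N -> G k.+1 (ny.2 i) &
      forall x, G k.+1 x -> exists2 i, (i < ny.1)%N &
        mdist (ny.2 i) x < 2 * eps ^+ k.+1].
  move=> k; have [|n [y nyP]] := @finite_net R X mu (G k.+1) (eps ^+ k.+1)
    (eps ^+ (k.+1 * S)) (ej0 _) (ej0 _).
    by move=> x [].
  by exists (n, y).
pose U k i : set X := if (i < (ny k).1)%N then
  ball ((ny k).2 i) (2 * eps ^+ k.+1) else set0.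
pose E := lim_sup_set (fun k => \bigcup_i U k i).
have oU k i : open (U k i).
  by rewrite /U; case: ifP => _; [exact: mball_open|exact: open0].
have mE : @measurable _ (borelType X) E.
  apply: bigcapT_measurable => k0; apply: bigcup_measurable => k _.
  by apply: open_borel; apply: bigcup_open => i _.
have muE : mu (~` E) = 0%E.
  have mCE : @measurable _ (borelType X) (~` E) by exact: measurableC.
  apply/(negligibleP mu mCE).
  apply: (negligibleS _ (negligibleU (heavy eps _) bad)); last first.
    by rewrite e0/=; lra.
  move=> x; apply: contra_notP => /not_orP[/contrapT xh /contrapT[k0 xk]].
  (* The heavy level is taken positive because [U k] is built from level [k.+1]. *)
  move=> k1 _; have [k kk hk] := xh (maxn k0 k1).+1.
  case: k kk hk => [//|k]; rewrite ltnS geq_max => /andP[k0k k1k] hk.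
  exists k => //; have Gx : G k.+1 x.
    split => //; apply: xk; first exact: leqW.
    by move: hk; rewrite !epsE mulnA.
  have [_ _ /(_ x Gx)[i ilt ix]] := nyP k.
  by exists i => //; rewrite /U ilt; exact/ballP.
apply: (@le_trans _ _ (@hausdorff_dim R (remetric D) E)).
  apply: ereal_inf_lbound; exists E => //; split => //.
  exact: borel_remetric.
apply: ereal_inf_lbound; exists p => //; split; first exact: ltW.
(* The 2 passes from radius to diameter, and [expR A / eps] from the weight at level [k.+1] to the
   one at level [k]. *)
pose C1 := 2 * expR A / eps.
have C10 : 0 < C1 by rewrite divr_gt0// mulr_gt0// expR_gt0.
pose d k := C1 * eps ^+ (B * k.+1).
apply: (@hausdorff_limsup R (remetric D) p (C1 + C1 `^ p) eps E U
  (fun k => (ny k).1) d) => //.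
- by rewrite addr_gt0// powR_gt0.
- by rewrite e0; lra.
- move=> k i; rewrite /U; case: ifP => ik; last first.
    apply: ge_ereal_sup => _ [->|[[? ?] [[]]]//].
    by rewrite lee_fin mulr_ge0 ?exprn_ge0// ltW.
  have [_ /(_ i ik) Gy _] := nyP k; set y := (ny k).2 i in Gy *.
  have Dy x : mdist y x < 2 * eps ^+ k.+1 -> D y x <= d k / 2.
    move=> yx; have yk : mdist y x <= eps ^+ k.
      by move: yx; rewrite exprS; have := ej0 k; nra.
    apply: (le_trans (Dle k y x _)); first by rewrite yk orbT.
    rewrite (max_idPr yk).
    have rS := @rhoS_ge R X A u A0 u_itv k y.
    apply: (@le_trans _ _ (expR A / eps * (rho A u k.+1 y * eps ^+ k.+1))).
      rewrite exprS (_ : _ / _ * _ = expR A * rho A u k.+1 y * eps ^+ k).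
        by rewrite ler_wpM2r// ltW.
      by field; rewrite gt_eqF.
    rewrite (_ : d k / 2 = expR A / eps * eps ^+ (B * k.+1)).
      by rewrite ler_wpM2l ?divr_ge0 ?expR_ge0 ?(ltW e0)// decay.
    by rewrite /d /C1; field; rewrite gt_eqF.
  apply: ge_ereal_sup => _ [->|[[x x'] [/ballP yx /ballP yx'] <-]].
    by rewrite lee_fin mulr_ge0 ?exprn_ge0// ltW.
  rewrite lee_fin; apply: (le_trans (metric_fun_triangle D y x x')).
  by rewrite metric_funC [leRHS]splitr lerD// Dy.
- move=> k; have dk0 : 0 <= eps ^+ (B * k.+1) by exact: ltW.
  apply/andP; split; first by rewrite mulr_ge0// ltW.
  apply: ler_pM => //; [exact: ltW|by rewrite lerDl powR_ge0|].
  rewrite ler_wiXn2l ?(ltW e0)//; first by lra.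
  by rewrite (leq_trans (leqnSn k))// leq_pmull.
- move=> k; have [nk _ _] := nyP k.
  rewrite /d (powRM _ (ltW C10) (ltW (ej0 _))).
  have Ep : (eps ^+ (B * k.+1)) `^ p <= eps ^+ (k.+1 * S) * eps ^+ k.
    rewrite -powR_mulrn ?(ltW e0)// -powRrM -exprD -powR_mulrn ?(ltW e0)//.
    apply: ger_powR; first by rewrite e0; lra.
    apply: (@le_trans _ _ (S.+1%:R * k.+1%:R)).
      by rewrite -natrM ler_nat [leqRHS]mulnC mulnS addnC leq_add2r.
    by rewrite natrM mulrAC ler_wpM2r.
  apply: (@le_trans _ _ (C1 `^ p * eps ^+ k)); last first.
    by rewrite ler_wpM2r ?(ltW (ej0 k))// lerDr ltW.
  rewrite mulrCA ler_wpM2l ?powR_ge0//.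
  apply: (@le_trans _ _ ((ny k).1%:R * (eps ^+ (k.+1 * S) * eps ^+ k))).
    by rewrite ler_wpM2l.
  by rewrite mulrA ler_piMl// ltW.
move=> x k0 /(_ k0 I)[k k0k [i _ Uix]]; exists k, i; split => //.
have [//|ik] := boolP (i < (ny k).1)%N.
by move: Uix; rewrite /U (negbTE ik).
Qed.

End Construction.

Theorem theorem1p3 (R : realType) (X : pmetricType R)
    (mu : probability (borelType X) R)
    (hsep : separable X)
    (hsupp : full_support X mu)
    (hdim : (hausdorff_dim_measure X mu < +oo)%E) :
  (forall p : R, 0 < p ->
     exists2 D : metric_on R X, qs_equivalent D &
       (hausdorff_dim_measure (remetric D) mu <= p%:E)%E) /\
  conformal_dim X mu = 0%E.
Proof.
have small p : 0 < p -> exists2 D : metric_on R X, qs_equivalent D &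
    (hausdorff_dim_measure (remetric D) mu <= p%:E)%E.
  by move=> p0; exact: small_dimension_metric.
split=> //; apply/eqP; rewrite eq_le; apply/andP; split; last first.
  apply: le_ereal_inf_tmp => _ [Y [f [_ ->]]].
  apply: le_ereal_inf_tmp => _ [E _ <-]; apply: le_ereal_inf_tmp.
  by move=> _ [s [s0 _] <-]; rewrite lee_fin.
(* The identity onto the space with metric [D] competes in the conformal dimension, and it pushes
   [mu] forward to itself. *)
apply/lee_addgt0Pr => p p0; rewrite add0e; have [D qsD dimD] := small p p0.
apply: le_trans dimD; apply: ereal_inf_lbound.
by exists (remetric D), id.
Qed.
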